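(* Let $T$ be an irreducible triangulation of a closed surface other than the sphere $S_0$, and let $v$ be a vertex of $T$. Then there exist two nonseparating 3-cycles $v v_i v_k$ and $v v_j v_l$ in $T$ such that $v_i$, $v_j$, $v_k$, $v_l$ are four distinct vertices, and, of the two paths from $v_i$ to $v_k$ in $\mathrm{lk}(v)$, one contains $v_j$ and the other contains $v_l$.
   Context: A triangulation of a closed surface is a simple graph embedded in the surface such that each face is a triangle and any two faces share at most one edge. For an edge $ac$ with incident faces $abc$ and $acd$, the contraction of $ac$ deletes $ac$, identifies $a$ and $c$, and removes one of each pair of resulting multiple edges ($ab$/$cb$ and $ad$/$cd$). An edge is contractible if its contraction yields a triangulation of the same surface; for triangulations other than $K_4$ on the sphere, an edge is non-contractible iff it lies on at least three 3-cycles (i.e. on some non-facial 3-cycle). A triangulation is irreducible if it has no contractible edges. The link $\mathrm{lk}(v)$ of a vertex $v$ is the cycle through the neighbours of $v$ formed by the edges of the faces incident to $v$ opposite $v$. A 3-cycle $abc$, embedded as a closed curve $C$ in the surface $S$, is separating if $S - C$ is disconnected and nonseparating otherwise. *)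

(* Defs.v *)
From HB Require Import structures.
From mathcomp Require Import all_boot all_order all_algebra.
From mathcomp Require Import all_classical all_reals all_analysis.

Set Implicit Arguments.
Unset Strict Implicit.
Unset Printing Implicit Defensive.

Import Order.TTheory GRing.Theory Num.Theory.
Import numFieldNormedType.Exports.

Local Open Scope classical_set_scope.
Local Open Scope ring_scope.

(* A finite simplicial complex on the labels V is given by a family of simplices
   (vertex sets); labels outside [vertices K] are not vertices of the complex. *)

Definition vertices (V : finType) (K : {set {set V}}) : {set V} := finset.cover K.

(* Geometric realization in barycentric coordinates: the points supported on
   some simplex of K. *)
Definition realization (R : realType) (V : finType) (K : {set {set V}}) :
    set {ptws V -> R} :=
  [set x | [/\ forall i, 0 <= x i, \sum_i x i = 1
             & exists2 s : {set V}, s \in K & forall i, x i != 0 -> i \in s]].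
Arguments realization R {V} K _.

Definition sphere (R : realType) : set {ptws 'I_3 -> R} :=
  [set x | \sum_i x i ^+ 2 = 1].
Arguments sphere R _ : clear implicits.

Definition homeomorphic (X Y : topologicalType) (A : set X) (B : set Y) : Prop :=
  exists (f : X -> Y) (g : Y -> X),
    [/\ {within A, continuous f}, {within B, continuous g},
        forall x, A x -> B (f x) /\ g (f x) = x
      & forall y, B y -> A (g y) /\ f (g y) = y].

Definition adj (V : finType) (F : {set {set V}}) (x y : V) : bool :=
  (x != y) && [exists f in F, (x \in f) && (y \in f)].

(* The cyclic sequence p is the link of v: its consecutive pairs are exactly the
   edges opposite v in the faces incident to v. *)
Definition is_link (V : finType) (F : {set {set V}}) (v : V) (p : seq V) : Prop :=
  [/\ uniq p, (2 < size p)%N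
    & forall x y, ([set v; x; y]%SET \in F) =
        (x \in p) && ((y == next p x) || (y == prev p x))].

(* A triangulation is given by its faces, each being its set of three vertices.
   Since the graph is simple and two faces share at most one edge, faces are
   determined by their vertices; the triangulated surface is the realization,
   a closed surface because it is connected and all links are cycles. *)
Definition triangulation (R : realType) (V : finType) (F : {set {set V}}) : Prop :=
  [/\ F != finset.set0,
      forall f, f \in F -> #|f| = 3%N,
      forall v, v \in vertices F -> exists p, is_link F v p
    & connected (realization R F)].

(* Identification of c with a; the two faces containing the edge ac collapse,
   and the edges xa, xc become the single edge xa. If this happens for some x
   with xac not a face, the link of a or of x is not a cycle in the result, which
   is then not a triangulation. *)
Definition contract_edge (V : finType) (F : {set {set V}}) (a c : V) : {set {set V}} :=
  let merge := fun x => if x == c then a else x in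
  [set (merge @: (f : {set V}))%SET | f in F & ~~ ((a \in f) && (c \in f))]%SET.

Definition contractible_edge (R : realType) (V : finType) (F : {set {set V}})
    (a c : V) : Prop :=
  [/\ adj F a c, triangulation R (contract_edge F a c)
    & homeomorphic (realization R (contract_edge F a c)) (realization R F)].

Definition irreducible_triangulation (R : realType) (V : finType)
    (F : {set {set V}}) : Prop :=
  triangulation R F /\ forall a c, ~ contractible_edge R F a c.

Definition cycle3 (V : finType) (F : {set {set V}}) (a b c : V) : bool :=
  [&& adj F a b, adj F b c & adj F a c].

Definition curve3 (R : realType) (V : finType) (a b c : V) : set {ptws V -> R} :=
  realization R [set [set a; b]; [set b; c]; [set a; c]]%SET.
Arguments curve3 R {V} a b c _.

Definition nonseparating3 (R : realType) (V : finType) (F : {set {set V}})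
    (a b c : V) : Prop :=
  cycle3 F a b c /\ connected (realization R F `\` curve3 R a b c).

(* The path from x to y along the cyclic sequence p, endpoints included; the
   other path between x and y in p is [link_path p y x], reversed. *)
Definition link_path (V : finType) (p : seq V) (x y : V) : seq V :=
  rcons (arc p x y) y.

(* Main.v *)
(* In an irreducible triangulation other than the tetrahedron every edge at v lies
   on a nonfacial 3-cycle, so every vertex of the link of v is the end of a chord,
   an edge between two nonconsecutive vertices of the link.  A family of chords
   meeting every vertex of a cycle contains two chords that cross.  The two
   3-cycles through v that they span meet only at v, where they cross, so each of
   them joins the two sides of the other, and neither separates the surface.

   The topological input is that an edge ac on no nonfacial 3-cycle is contractible.
   Flipping the edges at c one by one, so that their new ends are at a, reduces the
   degree of c to three without changing the contraction of ac; then c is removed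
   from inside a triangle.  Both moves are homeomorphisms given by piecewise linear
   formulas in the barycentric coordinates. *)

Require Import Defs.
From mathcomp Require Import all_boot all_order all_algebra.
From mathcomp Require Import zify ring lra.
From mathcomp Require Import all_classical all_reals all_analysis.

Set Implicit Arguments.
Unset Strict Implicit.
Unset Printing Implicit Defensive.

Import Order.TTheory GRing.Theory Num.Theory.
Import numFieldNormedType.Exports.

(** * Cyclic sequences *)

(** Both moves push a point along one fixed vector by a piecewise linear amount. This amount can be
    read off the image, so the inverse is the push back along the same vector, and what remains to
    check is that images land in the right complex. Cutting the contraction into flips keeps each
    homeomorphism within a single quadrilateral or triangle. Nonseparation becomes a question about
    the graph: a point off the curve is joined by a segment to a vertex off the 3-cycle, so it
    suffices to connect the vertices outside the cycle by edges avoiding it. One crossing is enough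
    because the two sides are carried along the curve. The second chord joins the two arcs of the
    link of [v]; the two faces at the edge [v vi] have one third vertex on each arc, and these also
    lie on the two arcs of the link of [vi], and likewise at [vk]. So all neighbours of the cycle
    are connected, and connectedness of the surface gives the rest. The sphere is excluded in one
    place: a vertex of degree three whose neighbours span a face, where the triangulation is the
    tetrahedron. Longer links are needed for chords, since a link of length three has no two
    nonconsecutive vertices. *)

Section Cycles.

Variable T : eqType.
Implicit Types (p s : seq T) (a b c m x y : T).

Definition upair a b x y : bool :=
  ((x == a) && (y == b)) || ((x == b) && (y == a)).

Definition path_edge s s' x y : bool :=
  ((x, y) \in zip s s') || ((y, x) \in zip s s').

(** Edges are listed by zipping with the rotated sequence rather than through [next] and [prev]:
    inserting or deleting an entry behind the head then changes only the first pairs and leaves the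
    remaining path literally the same, as in [cyc_cons2] and [cyc_cons3]. *)
Definition cyc p x y : bool := path_edge p (rot 1 p) x y.

Lemma upairC a b x y : upair a b x y = upair b a x y.
Proof. by rewrite /upair orbC. Qed.

Lemma path_edge_cons a s b s' x y :
  path_edge (a :: s) (b :: s') x y = upair a b x y || path_edge s s' x y.
Proof.
rewrite /path_edge /= !in_cons /upair !xpair_eqE.
by rewrite [(y == a) && _]andbC orbACA.
Qed.

Lemma cyc_cons3 a c m s x y :
  cyc (a :: c :: m :: s) x y =
  [|| upair a c x y, upair c m x y | path_edge (m :: s) (rcons s a) x y].
Proof. by rewrite /cyc rot1_cons !path_edge_cons. Qed.

Lemma cyc_cons2 a m s x y :
  cyc (a :: m :: s) x y =
  upair a m x y || path_edge (m :: s) (rcons s a) x y.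
Proof. by rewrite /cyc rot1_cons !path_edge_cons. Qed.

Lemma mem_zip1 (s s' : seq T) x y : (x, y) \in zip s s' -> x \in s.
Proof.
elim: s s' => [|a s IH] [|b s'] //=; rewrite !in_cons xpair_eqE.
by case/orP=> [/andP[-> //]|/IH ->]; rewrite orbT.
Qed.

Lemma mem_zip2 (s s' : seq T) x y : (x, y) \in zip s s' -> y \in s'.
Proof.
elim: s s' => [|a s IH] [|b s'] //=; rewrite !in_cons xpair_eqE.
by case/orP=> [/andP[_ -> //]|/IH ->]; rewrite orbT.
Qed.

Lemma rot1_next p : uniq p -> rot 1 p = map (next p) p.
Proof.
case: p => // a s up; apply: (@eq_from_nth _ a); first by rewrite size_map size_rot.
move=> i; rewrite size_rot => li.
rewrite (nth_map a) // next_nth mem_nth // index_uniq // rot1_cons nth_rcons.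
move: li; rewrite /= ltnS leq_eqVlt => /orP[/eqP->|li].
  by rewrite ltnn eqxx [in RHS]nth_default.
by rewrite li.
Qed.

Lemma cyc_next p x y : uniq p ->
  cyc p x y = ((x \in p) && (y == next p x)) || ((y \in p) && (x == next p y)).
Proof.
move=> up; rewrite /cyc /path_edge rot1_next //.
have H (u w : T) (s : seq T) : (u, w) \in zip s (map (next p) s) =
    (u \in s) && (w == next p u).
  elim: s => //= b s IH; rewrite !in_cons xpair_eqE IH.
  by case: eqVneq => [->|] //=; case: (w == _); rewrite ?andbF.
by rewrite !H.
Qed.

Lemma cyc_nextprev p x y : uniq p ->
  cyc p x y = (x \in p) && ((y == next p x) || (y == prev p x)).
Proof.
move=> up; rewrite cyc_next // andb_orr; congr orb.
apply/andP/andP=> [[yp /eqP ->]|[xp /eqP ->]].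
  by rewrite mem_next prev_next.
by rewrite mem_prev next_prev.
Qed.

Lemma cycC p x y : cyc p x y = cyc p y x.
Proof. by rewrite /cyc /path_edge orbC. Qed.

Lemma cyc_mem p x y : cyc p x y -> (x \in p) && (y \in p).
Proof.
rewrite /cyc /path_edge.
by case/orP=> H; rewrite (mem_zip1 H) -(mem_rot 1) (mem_zip2 H).
Qed.

Lemma cyc_rot n p : uniq p -> cyc (rot n p) =2 cyc p.
Proof.
by move=> up x y; rewrite !cyc_nextprev ?rot_uniq // mem_rot next_rot // prev_rot.
Qed.

Lemma cyc_rev p : uniq p -> cyc (rev p) =2 cyc p.
Proof.
move=> up x y; rewrite !cyc_nextprev ?rev_uniq // mem_rev next_rev // prev_rev //.
by rewrite [(_ == prev _ _) || _]orbC.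
Qed.

Lemma cyc_head x s y : uniq (x :: s) ->
  cyc (x :: s) x y = (y == head x s) || (y == last x s).
Proof.
move=> us; rewrite cyc_nextprev // mem_head next_nth prev_nth mem_head index_head.
move: us => /= /andP[xs _].
rewrite memNindex // nth0 (_ : nth x (x :: s) (size s) = last x s) //.
exact: (nth_last x (x :: s)).
Qed.

Lemma cyc_cons_split x s1 y s2 : s1 != [::] -> s2 != [::] ->
  uniq (x :: s1 ++ y :: s2) -> cyc (x :: s1 ++ y :: s2) x y = false.
Proof.
case: s1 => // a s1; case: s2 => // b s2 _ _ us; rewrite cyc_head //=.
rewrite last_cat /=; move: us; rewrite -cat_cons -cat_rcons cat_uniq.
rewrite rcons_uniq => /and3P[/andP[ya _] ns _].
move: ya; rewrite !in_cons !negb_or => /and3P[_ /negbTE -> _] /=.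
apply/negP=> /eqP ey; move/negP: ns; apply.
apply/hasP; exists (last b s2); first by rewrite mem_last.
by rewrite -ey mem_rcons mem_head.
Qed.

Lemma cyc_nextp p x : uniq p -> x \in p -> cyc p x (next p x).
Proof. by move=> up xp; rewrite cyc_nextprev // xp eqxx. Qed.

Lemma path_edge_neq s s' c x y : c \notin s -> c \notin s' ->
  path_edge s s' x y -> x != c /\ y != c.
Proof.
move=> cs cs' /orP[H|H]; move: (mem_zip1 H) (mem_zip2 H) => H1 H2; split.
all: by apply/eqP=> E; move: cs cs'; rewrite -E ?H1 ?H2.
Qed.

(** The path runs from [m] through [s] back to [a]; it needs an inner vertex, since for empty [s] it
    is the edge [ma] itself. *)
Lemma path_edge_notin m s a x y :
  uniq (a :: m :: s) -> s != [::] -> path_edge (m :: s) (rcons s a) x y ->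
  ~~ upair a m x y.
Proof.
case: s => // b s us _.
have /andP[] : (a \notin [:: m, b & s]) && (m \notin b :: s).
  by move: us => /= /and3P[-> ->].
rewrite !in_cons !negb_or => /and3P[am ab as_] /andP[mb ms].
have K : (a, m) \notin zip [:: m, b & s] (rcons (b :: s) a).
  by apply/negP=> /mem_zip1; rewrite !in_cons (negbTE am) (negbTE ab) (negbTE as_).
have K' : (m, a) \notin zip [:: m, b & s] (rcons (b :: s) a).
  rewrite /= in_cons xpair_eqE (negbTE ab) andbF /=.
  by apply/negP=> /mem_zip1; rewrite !in_cons (negbTE mb) (negbTE ms).
rewrite -negb_or; apply: contraL.
by case/orP=> /andP[/eqP-> /eqP->]; rewrite /path_edge (negbTE K) (negbTE K').
Qed.

End Cycles.

(** * Faces and links *)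

Section Links.

Local Open Scope set_scope.

Variable V : finType.
Implicit Types (F : {set {set V}}) (v x y a b c m : V) (p q s : seq V).

Definition link F v p : Prop :=
  [/\ uniq p, 2 < size p & forall x y, ([set v; x; y] \in F) = cyc p x y].

Definition triples F : Prop := forall f, f \in F -> #|f| = 3.

Definition has_links F : Prop :=
  forall v, v \in vertices F -> exists p, link F v p.

Lemma is_linkP F v p : is_link F v p <-> link F v p.
Proof.
by split=> -[up sp H]; split=> // x y; rewrite H ?cyc_nextprev // -cyc_nextprev.
Qed.

Lemma upair_refl a b : upair a b a b.
Proof. by rewrite /upair !eqxx. Qed.

Lemma set3C v x y : [set v; x; y] = [set v; y; x].
Proof. by apply/setP=> z; rewrite !inE -!orbA; congr orb; rewrite orbC. Qed.

Lemma set3CA v x y : [set v; x; y] = [set x; v; y].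
Proof. by rewrite [[set v; x]]finset.setUC. Qed.

Lemma set3_rot v x y : [set v; x; y] = [set x; y; v].
Proof. by rewrite set3CA set3C. Qed.

Lemma set3_card v x y : #|[set v; x; y]| = 3 -> [/\ v != x, v != y & x != y].
Proof.
move=> H; split; apply/negP=> /eqP E; move: H; rewrite E.
- by rewrite finset.setUid cards2; case: (_ != _).
- by rewrite set3C finset.setUid cards2; case: (_ != _).
by rewrite set3_rot finset.setUid cards2; case: (_ != _).
Qed.

Lemma set3_eq a b c x y : a != b -> a != c -> b != c ->
  ([set a; x; y] == [set a; b; c]) = upair b c x y.
Proof.
move=> ab ac bc; apply/eqP/idP=> [E|/orP[/andP[/eqP-> /eqP->]|/andP[/eqP-> /eqP->]]] //;
  last by rewrite set3C.
have /set3_card[ax ay xy] : #|[set a; x; y]| = 3.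
  by rewrite E -finset.setUA cardsU1 cards2 !inE negb_or bc ab ac.
have : x \in [set a; b; c] by rewrite -E !inE eqxx orbT.
have : y \in [set a; b; c] by rewrite -E !inE eqxx orbT.
rewrite !inE ![_ == a]eq_sym (negbTE ax) (negbTE ay) /upair /=.
move=> /orP[/eqP yE|/eqP yE] /orP[/eqP xE|/eqP xE]; subst; rewrite ?eqxx ?orbT //.
all: by rewrite eqxx in xy.
Qed.

Lemma set3_neq v a b c x y : v != a -> v != b -> v != c ->
  ([set v; x; y] == [set a; b; c]) = false.
Proof.
move=> va vb vc; apply/negP=> /eqP E.
have : v \in [set a; b; c] by rewrite -E !inE eqxx.
by rewrite !inE (negbTE va) (negbTE vb) (negbTE vc).
Qed.

Lemma card3_set3 (s : {set V}) a b c : #|s| = 3 ->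
  a \in s -> b \in s -> c \in s -> a != b -> a != c -> b != c -> s = [set a; b; c].
Proof.
move=> s3 sa sb sc ab ac bc; apply/esym/eqP.
have c3 : #|[set a; b; c]| = 3.
  by rewrite -finset.setUA cardsU1 cards2 !inE negb_or bc ab ac.
rewrite eqEcard s3 c3 leqnn andbT; apply/fintype.subsetP => x.
by rewrite !inE -orbA => /or3P[]/eqP->.
Qed.

Lemma set3_face {F v x y} : triples F -> [set v; x; y] \in F ->
  [/\ v != x, v != y & x != y].
Proof. by move=> t3 /t3 /set3_card. Qed.

Lemma mem_vertices F v : reflect (exists2 f, f \in F & v \in f) (v \in vertices F).
Proof. exact: bigcupP. Qed.

Lemma face3 F f v : triples F -> f \in F -> v \in f ->
  exists x y, f = [set v; x; y].
Proof.
move=> t3 fF vf; have := t3 _ fF; rewrite (cardsD1 v) vf => -[] /eqP.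
case/cards2P => x [y [xy E]]; exists x, y.
by rewrite -(finset.setD1K vf) E finset.setUA.
Qed.

Lemma adjP F x y : triples F ->
  reflect (exists z, [set x; y; z] \in F) (adj F x y).
Proof.
move=> t3; apply: (iffP andP) => [[xy /existsP[f /andP[fF /andP[xf yf]]]]|[z H]].
  have [a [b E]] := face3 t3 fF xf.
  move: yf; rewrite E !inE eq_sym (negbTE xy) /= => /orP[] /eqP ->.
    by exists b; rewrite -E.
  by exists a; rewrite set3C -E.
have [xy _ _] := set3_face t3 H; split=> //.
by apply/existsP; exists [set x; y; z]; rewrite H !inE !eqxx orbT.
Qed.

Lemma adjC F x y : adj F x y = adj F y x.
Proof.
rewrite /adj eq_sym; congr andb; apply: eq_existsb => f.
by rewrite [(x \in f) && _]andbC.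
Qed.

Lemma adj_vertices F x y : adj F x y -> y \in vertices F.
Proof.
by case/andP=> _ /existsP[f /andP[fF /andP[_ yf]]]; apply/mem_vertices; exists f.
Qed.

Lemma face_adj F x y z : triples F -> [set x; y; z] \in F ->
  [/\ adj F x y, adj F x z & adj F y z].
Proof.
move=> t3 H; split; apply/adjP => //; [by exists z|by exists y; rewrite set3C|].
by exists x; rewrite -set3_rot.
Qed.

Lemma face_vertices F x y z : [set x; y; z] \in F ->
  [/\ x \in vertices F, y \in vertices F & z \in vertices F].
Proof.
by move=> H; split; apply/mem_vertices; exists [set x; y; z]; rewrite // !inE eqxx ?orbT.
Qed.

Lemma link_rot n F v p : link F v p -> link F v (rot n p).
Proof.
move=> [up sp H]; split; rewrite ?rot_uniq ?size_rot // => x y.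
by rewrite cyc_rot.
Qed.

Lemma link_rev F v p : link F v p -> link F v (rev p).
Proof.
move=> [up sp H]; split; rewrite ?rev_uniq ?size_rev // => x y.
by rewrite cyc_rev.
Qed.

Lemma link_from F v p x : link F v p -> x \in p ->
  exists n s, rot n p = x :: s /\ link F v (x :: s).
Proof.
by move=> L /rot_to[n s E]; exists n, s; rewrite -E; split=> //; exact: link_rot.
Qed.

Lemma link_adj F v p x : triples F -> link F v p -> (x \in p) = adj F v x.
Proof.
move=> t3 [up sp H]; apply/idP/adjP => // [xp|[z]].
  by exists (next p x); rewrite H cyc_nextp.
by rewrite H => /cyc_mem /andP[].
Qed.

Lemma link_notin F v p : triples F -> link F v p -> v \notin p.
Proof. by move=> t3 L; rewrite (link_adj _ t3 L) /adj eqxx. Qed.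

(** Rotations and reversals of a link are again links; a reversal is needed when [y] precedes [x] in
    the given orientation. *)
Lemma link_edge F v x y : has_links F -> [set v; x; y] \in F ->
  exists s, link F v (x :: y :: s).
Proof.
move=> hl vF; have [v_ _ _] := face_vertices vF.
have [p L] := hl v v_; case: (L) => up sp H.
have : cyc p x y by rewrite -H.
rewrite cyc_nextprev // => /andP[xp]; wlog Hy : p L up sp H xp / y == next p x.
  move=> W /orP[] yE; first by apply: (W p) => //; rewrite yE.
  have Lr := link_rev L; case: (Lr) => ur sr Hr.
  by apply: (W (rev p)) => //; rewrite ?mem_rev ?next_rev // yE.
move=> _; have [n [s [E Ls]]] := link_from L xp.
move: Hy; rewrite -(next_rot n) // E.
case: s Ls E => [|z s] Ls E; first by case: Ls.
by rewrite next_nth mem_head index_head /= => /eqP ->; exists s.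
Qed.

Lemma link_edge2 F v a c m : has_links F -> [set v; a; c] \in F ->
  [set v; c; m] \in F -> a != m -> exists s, link F v (a :: c :: m :: s).
Proof.
move=> hl H1 H2 am; have [s L] := link_edge hl H1.
case: s L => [|m' s] L; first by case: L.
case: (L) => ul _ Hl; move: H2; rewrite Hl -(cyc_rot 1 ul) rot1_cons.
have ur : uniq (rcons [:: c, m' & s] a) by rewrite -rot1_cons rot_uniq.
rewrite rcons_cons cyc_head // last_rcons /=.
by rewrite [m == a]eq_sym (negbTE am) orbF => /eqP ->; exists s.
Qed.

(** Three faces around [v] already close up: if the link continued with some [w] after [z], the
    neighbours of [z] in it would be [y] and [w], leaving no place for [x]. *)
Lemma link_triangle F v x y z : has_links F -> [set v; x; y] \in F ->
  [set v; y; z] \in F -> [set v; z; x] \in F -> x != z ->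
  link F v [:: x; y; z].
Proof.
move=> hl Hxy Hyz Hzx xz; have [[//|w s] L] := link_edge2 hl Hxy Hyz xz.
case: (L) => us _ Hl; move: Hzx; rewrite Hl -(cyc_rot 2 us).
have ur : uniq (rot 2 [:: x, y, z, w & s]) by rewrite rot_uniq.
move: us ur; rewrite /rot /= ?drop0 => /and4P[xs ys _ _] ur.
rewrite cyc_head //= last_cat /=; move: xs ys; rewrite !in_cons !negb_or.
by case/and4P=> /negbTE -> _ /negbTE -> _.
Qed.

Lemma link_insert F F' v c m y s :
    link F v (c :: y :: s) -> m \notin c :: y :: s ->
    (forall x z, ([set v; x; z] \in F') =
       [|| ([set v; x; z] \in F) && ~~ upair c y x z, upair c m x z
         | upair m y x z]) ->
  link F' v [:: c, m, y & s].
Proof.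
move=> [us ss H] mn H'; split.
- by move: mn us; rewrite /= !in_cons !negb_or eq_sym => /and3P[-> -> ->] /and3P[-> -> ->].
- by move: ss => /=; rewrite !ltnS => /ltnW.
move=> x z; rewrite H' H cyc_cons3 cyc_cons2.
have s0 : s != [::] by case: (s) ss.
case E : (path_edge _ _ _ _).
  by rewrite orbT (path_edge_notin us s0 E) !orbT.
by rewrite orbF andbN /= orbF.
Qed.

(** Serves both the ends of the old diagonal of a flip and the neighbours of a removed vertex. The
    condition on [s] leaves at least three entries after the deletion. *)
Lemma link_delete F F' v a c m s :
    link F v [:: a, c, m & s] -> s != [::] ->
    (forall x z, ([set v; x; z] \in F') =
       [|| [&& [set v; x; z] \in F, ~~ upair a c x z & ~~ upair c m x z]
         | upair a m x z]) ->
  link F' v [:: a, m & s].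
Proof.
move=> [us ss H] s0 H'; split.
- by move: us; rewrite /= !in_cons !negb_or => /and4P[/and3P[_ -> ->] _ -> ->].
- by case: (s) s0.
move=> x z; rewrite H' H cyc_cons3 cyc_cons2.
case E : (path_edge _ _ _ _); last first.
  by rewrite orbF; case: (upair a c x z); case: (upair c m x z); rewrite /= ?orbF.
have /andP[c1 c2] : (c \notin m :: s) && (c \notin rcons s a).
  move: us; rewrite /= mem_rcons !in_cons !negb_or [c == a]eq_sym.
  by case/and4P=> /and3P[-> _ _] /andP[-> ->].
have [xc zc] := path_edge_neq c1 c2 E.
by rewrite /upair (negbTE xc) (negbTE zc) !andbF /= !orbT.
Qed.

End Links.

(** * Edge flips and removal of a vertex of degree three *)

Section Moves.

Local Open Scope set_scope.

Variable V : finType.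
Implicit Types (F : {set {set V}}) (v x y a b c m : V) (p q s : seq V).

(** In the quadrilateral with sides [ac], [cm], [my], [ya], the diagonal [cy] is exchanged for [am].
    Seen from the edge [ac], the vertex [c] gives up its neighbour [y] and [a] gains [m]. *)
Definition flip F a c y m : {set {set V}} :=
  F :\: [set [set a; c; y]; [set c; y; m]] :|: [set [set a; y; m]; [set a; c; m]].

Lemma flipE F a c y m f : (f \in flip F a c y m) =
  [|| [&& f \in F, f != [set a; c; y] & f != [set c; y; m]],
      f == [set a; y; m] | f == [set a; c; m]].
Proof. by rewrite !inE negb_or andbC. Qed.

(** With [flip_sym], these reflections of the quadrilateral reduce its four corners to two cases: an
    end of the new diagonal gains a link vertex, an end of the old one loses one. *)
Lemma flipC F a c y m : flip F a c y m = flip F a y c m.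
Proof.
apply/setP=> f; rewrite !flipE (set3C a c y) (set3CA c y m).
by congr orb; rewrite orbC.
Qed.

Lemma flip_sym F a c y m : flip F a c y m = flip F m c y a.
Proof.
apply/setP=> f; rewrite !flipE.
rewrite -(set3_rot m c y) (set3_rot a c y) (set3_rot m y a) (set3CA y a m).
rewrite (set3_rot m c a) (set3CA c a m).
by congr orb; rewrite [X in _ && X]andbC.
Qed.

Section Flip.

Variables (F : {set {set V}}) (a c y m : V).
Hypotheses (t3 : triples F) (hl : has_links F).
Hypotheses (acy : [set a; c; y] \in F) (cym : [set c; y; m] \in F).
Hypotheses (am : a != m) (nam : ~~ adj F a m).

Let neqs : [/\ a != c, a != y, c != y, c != m & y != m].
Proof. by have [-> -> ->] := set3_face t3 acy; have [_ -> ->] := set3_face t3 cym. Qed.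

Lemma flip_triples : triples (flip F a c y m).
Proof.
have [ac ay cy cm ym] := neqs.
move=> f; rewrite flipE => /or3P[/and3P[/t3 //]|/eqP->|/eqP->].
  by rewrite -finset.setUA cardsU1 cards2 !inE negb_or ym ay am.
by rewrite -finset.setUA cardsU1 cards2 !inE negb_or cm ac am.
Qed.

Lemma flip_link_insert s : link F a (c :: y :: s) ->
  link (flip F a c y m) a [:: c, m, y & s].
Proof.
have [ac ay cy cm ym] := neqs.
move=> L; apply: (link_insert L); first by rewrite (link_adj _ t3 L).
move=> x z; rewrite flipE set3_eq // (set3_neq _ _ ac ay am) !andbT set3_eq // set3_eq //.
congr orb; by rewrite orbC (upairC y m).
Qed.

Lemma flip_link_delete s : link F c [:: a, y, m & s] ->
  link (flip F a c y m) c [:: a, m & s].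
Proof.
have [ac ay cy cm ym] := neqs.
have [ca my] : c != a /\ m != y by split; rewrite eq_sym.
move=> L; apply: (link_delete L).
  (* For empty [s] the link of [c] would be the triangle [a y m], so [cam] would be a face and [a],
     [m] adjacent. *)
  case: s L => // -[ul _ Hl]; case/negP: nam.
  apply/adjP=> //; exists c.
  by rewrite -set3_rot Hl cyc_head //= eqxx orbT.
move=> x z; rewrite flipE (set3CA a c y) set3_eq // set3_eq //.
rewrite (set3_neq _ _ ca cy cm) (set3CA a c m) set3_eq //.
Qed.

Lemma flip_link_other v s : v != a -> v != c -> v != y -> v != m ->
  link F v s -> link (flip F a c y m) v s.
Proof.
move=> va vc vy vm [us ss H]; split=> // x z.
by rewrite flipE !set3_neq // !andbT !orbF.
Qed.

End Flip.

Lemma flip_links F a c y m : triples F -> has_links F ->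
  [set a; c; y] \in F -> [set c; y; m] \in F -> a != m -> ~~ adj F a m ->
  has_links (flip F a c y m).
Proof.
move=> t3 hl acy cym am nam v vF'.
have vF : v \in vertices F.
  have [a_ c_ y_] := face_vertices acy; have [_ _ m_] := face_vertices cym.
  move: vF' => /mem_vertices[f]; rewrite flipE.
  case/or3P=> [/and3P[fF _ _] vf|/eqP->|/eqP->]; first by apply/mem_vertices; exists f.
    by rewrite !inE -orbA => /or3P[] /eqP->.
  by rewrite !inE -orbA => /or3P[] /eqP->.
have mcy : [set m; c; y] \in F by rewrite set3_rot.
have cya : [set c; y; a] \in F by rewrite -set3_rot.
have ma : m != a by rewrite eq_sym.
have nma : ~~ adj F m a by rewrite adjC.
have [va|va] := eqVneq v a.
  by have [s L] := link_edge hl acy; rewrite va; eexists; apply: flip_link_insert L.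
have [vm|vm] := eqVneq v m.
  have [s L] := link_edge hl mcy; rewrite vm flip_sym.
  by eexists; apply: flip_link_insert L.
have [vc|vc] := eqVneq v c.
  have cay : [set c; a; y] \in F by rewrite set3CA.
  have [s L] := link_edge2 hl cay cym am; rewrite vc.
  by eexists; apply: flip_link_delete L.
have [vy|vy] := eqVneq v y.
  have yac : [set y; a; c] \in F by rewrite set3_rot.
  have ycm : [set y; c; m] \in F by rewrite set3CA.
  have ayc : [set a; y; c] \in F by rewrite set3C.
  have [s L] := link_edge2 hl yac ycm am; rewrite vy flipC.
  by eexists; apply: flip_link_delete L.
by have [p L] := hl v vF; exists p; apply: flip_link_other.
Qed.

Lemma flip_adj F a c y m x z : triples F -> triples (flip F a c y m) ->
  a != x -> x \notin [set c; y; m] -> adj (flip F a c y m) x z -> adj F x z.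
Proof.
move=> t3 t3'; rewrite !inE !negb_or -!andbA => ax /and3P[xc xy xm].
have xa : x != a by rewrite eq_sym.
case/adjP=> // w; rewrite flipE !set3_neq // !andbT !orbF => H.
by apply/adjP => //; exists w.
Qed.

Definition merge a c x : V := if x == c then a else x.

Lemma merge_id a c (f : {set V}) : c \notin f -> merge a c @: f = f.
Proof.
move=> cf; rewrite -[RHS]imset_id; apply: eq_in_imset => x xf.
by rewrite /merge; case: eqVneq => // E; rewrite -E xf in cf.
Qed.

Lemma merge3 a c x y : x != c -> y != c -> merge a c @: [set c; x; y] = [set a; x; y].
Proof.
move=> /negbTE xc /negbTE yc.
by rewrite !imsetU !imset_set1 /merge eqxx xc yc.
Qed.

Lemma contractP F a c f :
  reflect (exists g, [/\ g \in F, ~~ ((a \in g) && (c \in g)) & f = merge a c @: g])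
    (f \in contract_edge F a c).
Proof.
apply: (iffP imsetP) => [[g]|[g [gF acg ->]]].
  by rewrite inE => /andP[gF acg] ->; exists g.
by exists g; rewrite // inE gF.
Qed.

(** Contraction does not see the flip: the old face [cym] is sent to [aym], which is the new face,
    while the old [acy] and the new [acm] both contain [ac] and collapse. *)
Lemma contract_flip F a c y m : triples F ->
  [set a; c; y] \in F -> [set c; y; m] \in F -> a != m ->
  contract_edge (flip F a c y m) a c = contract_edge F a c.
Proof.
move=> t3 acy cym am.
have [ac ay cy] := set3_face t3 acy; have [_ cm ym] := set3_face t3 cym.
have E : merge a c @: [set c; y; m] = [set a; y; m].
  by rewrite merge3 // eq_sym.
have cn : c \notin [set a; y; m] by rewrite !inE !negb_or eq_sym ac cy cm.
have an : a \notin [set c; y; m] by rewrite !inE !negb_or ay am ac.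
apply/setP=> f; apply/contractP/contractP=> -[g [gF acg ->]].
  move: gF; rewrite flipE => /or3P[/and3P[gF _ _]|/eqP Eg|/eqP Eg].
  - by exists g.
  - exists [set c; y; m]; split; rewrite ?(negbTE an) //.
    by rewrite Eg merge_id.
  by move: acg; rewrite Eg !inE !eqxx !orbT.
have [Eg|n1] := eqVneq g [set c; y; m].
  exists [set a; y; m]; split; rewrite ?flipE ?eqxx ?orbT ?(negbTE cn) ?andbF //.
  by rewrite Eg E merge_id.
exists g; split=> //; rewrite flipE gF n1 andbT.
case: eqVneq acg => //= ->; by rewrite !inE !eqxx !orbT.
Qed.

Definition remove3 F a c x y : {set {set V}} :=
  F :\: [set [set c; a; x]; [set c; a; y]; [set c; x; y]] :|: [set [set a; x; y]].

Lemma remove3E F a c x y f : (f \in remove3 F a c x y) =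
  [&& f \in F, f != [set c; a; x], f != [set c; a; y] & f != [set c; x; y]]
    || (f == [set a; x; y]).
Proof. by rewrite !inE !negb_or -!andbA; congr orb; do 3!bool_congr; rewrite !andbT. Qed.

(** With [remove3C'] this gives all permutations of [a], [x], [y], so that only the link of [a] has
    to be computed. *)
Lemma remove3C F a c x y : remove3 F a c x y = remove3 F x c a y.
Proof.
apply/setP=> f; rewrite !remove3E (set3C c a x) (set3CA a x y).
by congr orb; congr andb; congr andb; rewrite andbC.
Qed.

Lemma remove3C' F a c x y : remove3 F a c x y = remove3 F a c y x.
Proof.
apply/setP=> f; rewrite !remove3E (set3C c x y) (set3C a x y).
by congr orb; congr andb; rewrite andbCA.
Qed.

Section Remove.

Variables (F : {set {set V}}) (a c x y : V).
Hypotheses (t3 : triples F) (hl : has_links F) (Lc : link F c [:: a; x; y]).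
Hypothesis (naxy : [set a; x; y] \notin F).

Let neqs : [/\ c != a, c != x, c != y & [/\ a != x, a != y & x != y]].
Proof.
have := link_notin t3 Lc; have [ul _ _] := Lc.
move: ul; rewrite /= !in_cons !in_nil !orbF !negb_or !andbT.
by case/andP=> /andP[-> ->] -> /and3P[-> -> ->].
Qed.

Let cax : [set c; a; x] \in F.
Proof. by have [_ _ ->] := Lc; rewrite cyc_cons3 upair_refl. Qed.

Let cay : [set c; a; y] \in F.
Proof. by have [ul _ ->] := Lc; rewrite cyc_head //= eqxx orbT. Qed.

Let cxy : [set c; x; y] \in F.
Proof. by have [ul _ ->] := Lc; rewrite cyc_cons3 upair_refl orbT. Qed.

Lemma remove3_faces f : f \in F -> c \in f ->
  [\/ f = [set c; a; x], f = [set c; a; y] | f = [set c; x; y]].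
Proof.
move=> fF /(face3 t3 fF)[u [w E]]; move: fF; have [_ _ H] := Lc; rewrite E H.
rewrite cyc_cons3 /path_edge /= !inE !xpair_eqE.
case/orP=> [/orP[]/andP[/eqP-> /eqP->]|].
- by constructor 1.
- by constructor 1; rewrite set3C.
case/orP=> [/orP[]/andP[/eqP-> /eqP->]|].
- by constructor 3.
- by constructor 3; rewrite set3C.
case/orP=> /andP[/eqP-> /eqP->].
- by constructor 2; rewrite set3C.
by constructor 2.
Qed.

(** At a vertex of degree three the faces [cax] and [cay] collapse and [cxy] becomes [axy]. *)
Lemma contract_remove3 : contract_edge F a c = remove3 F a c x y.
Proof.
have [ca cx cy [ax ay xy]] := neqs.
have M : merge a c @: [set c; x; y] = [set a; x; y] by rewrite merge3 // eq_sym.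
have anc : a \notin [set c; x; y].
  by rewrite !inE !negb_or [a == c]eq_sym ca ax ay.
apply/setP=> f; apply/contractP/idP=> [[g [gF acg ->]]|].
  have [cg|cg] := boolP (c \in g).
    case: (remove3_faces gF cg) acg => ->; rewrite ?M; last by rewrite remove3E eqxx orbT.
      by rewrite !inE !eqxx !orbT.
    by rewrite !inE !eqxx !orbT.
  rewrite merge_id // remove3E gF /=; apply/orP; left.
  by apply/and3P; split; apply: contraNneq cg => ->; rewrite !inE eqxx.
rewrite remove3E => /orP[/and4P[fF f1 f2 f3]|/eqP->]; last first.
  by exists [set c; x; y]; rewrite M (negbTE anc).
have [cf|cf] := boolP (c \in f).
  by case: (remove3_faces fF cf) f1 f2 f3 => ->; rewrite eqxx.
by exists f; rewrite merge_id // (negbTE cf) andbF.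
Qed.

Lemma remove3_triples : triples (remove3 F a c x y).
Proof.
have [ca cx cy [ax ay xy]] := neqs.
move=> f; rewrite remove3E => /orP[/and4P[/t3]//|/eqP->].
by rewrite -finset.setUA cardsU1 cards2 !inE negb_or ax ay xy.
Qed.

Lemma remove3_vertices : c \notin vertices (remove3 F a c x y).
Proof.
have [ca cx cy [ax ay xy]] := neqs.
apply/mem_vertices=> -[f]; rewrite remove3E => /orP[/and4P[fF f1 f2 f3]|/eqP->].
  by move/(remove3_faces fF)=> E; case: E f1 f2 f3 => ->; rewrite eqxx.
by rewrite !inE (negbTE ca) (negbTE cx) (negbTE cy).
Qed.

End Remove.

Lemma remove3_link_delete F a c x y s : c != a -> c != x -> c != y -> a != x ->
  a != y -> x != y -> [set a; x; y] \notin F -> link F a [:: x, c, y & s] ->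
  link (remove3 F a c x y) a [:: x, y & s].
Proof.
move=> ca cx cy ax ay xy naxy L; apply: (link_delete L).
  case: s L => // -[ul _ Hl]; move: naxy.
  by rewrite Hl cyc_head //= eqxx orbT.
have ac : a != c by rewrite eq_sym.
have nxc : x != c by rewrite eq_sym.
move=> u w; rewrite remove3E (set3_eq _ _ ax ay xy) (set3CA c a x) (set3CA c a y).
rewrite (set3_neq _ _ ac ax ay) andbT (set3_eq _ _ ac ax cx) (set3_eq _ _ ac ay cy).
by rewrite (upairC x c).
Qed.

Lemma remove3_links F a c x y : triples F -> has_links F ->
  link F c [:: a; x; y] -> [set a; x; y] \notin F -> has_links (remove3 F a c x y).
Proof.
move=> t3 hl L naxy v vF'.
have cn := remove3_vertices t3 L.
have := link_notin t3 L; have [ul _ Hl] := L.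
move: (ul); rewrite /= !in_cons !in_nil !orbF !negb_or !andbT.
case/andP=> /andP[ax ay] xy /and3P[ca cx cy].
have [xa ya yx] : [/\ x != a, y != a & y != x] by split; rewrite eq_sym.
have cax : [set c; a; x] \in F by rewrite Hl cyc_cons3 upair_refl.
have cxy : [set c; x; y] \in F by rewrite Hl cyc_cons3 upair_refl orbT.
have cay : [set c; a; y] \in F by rewrite Hl cyc_head //= eqxx orbT.
have [_ a_ x_] := face_vertices cax; have [_ _ y_] := face_vertices cxy.
have vF : v \in vertices F.
  move: vF' => /mem_vertices[f]; rewrite remove3E.
  case/orP=> [/and4P[fF _ _ _] vf|/eqP->]; first by apply/mem_vertices; exists f.
  by rewrite !inE -orbA => /or3P[] /eqP->.
have [va|va] := eqVneq v a.
  have axc : [set a; x; c] \in F by rewrite -set3_rot.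
  have acy : [set a; c; y] \in F by rewrite set3CA.
  have [s La] := link_edge2 hl axc acy xy.
  by rewrite va; eexists; apply: remove3_link_delete La.
have [vx|vx] := eqVneq v x.
  have xac : [set x; a; c] \in F by rewrite -set3_rot set3C.
  have xcy : [set x; c; y] \in F by rewrite set3CA.
  have [s La] := link_edge2 hl xac xcy ay.
  by rewrite vx remove3C; eexists; apply: remove3_link_delete La; rewrite // set3CA.
have [vy|vy] := eqVneq v y.
  have yac : [set y; a; c] \in F by rewrite -set3_rot set3C.
  have ycx : [set y; c; x] \in F by rewrite set3CA set3C.
  have [s La] := link_edge2 hl yac ycx ax.
  rewrite vy remove3C' remove3C; eexists; apply: remove3_link_delete La => //.
  by rewrite set3_rot.
have vc : v != c by apply: contraNneq cn => {1}<-.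
have [p Lp] := hl v vF; case: (Lp) => up sp Hp; exists p; split=> // u w.
by rewrite remove3E !set3_neq //= !andbT orbF Hp.
Qed.

End Moves.

(** * Homeomorphisms of realizations *)

Section Shifts.

Local Open Scope classical_set_scope.
Local Open Scope ring_scope.

Variables (R : realType) (V : finType).
Implicit Types (F : {set {set V}}) (z w : {ptws V -> R}).

Lemma ptws_continuous_at (I : Type) (T : topologicalType) (f : T -> {ptws I -> R}) x :
  (forall i, {for x, continuous (fun t => f t i)}) -> {for x, continuous f}.
Proof.
move=> fc; apply/cvg_sup.
move=> i U [W [[B oB <-] Bx] WU]; apply: (filterS WU).
apply: (fc i); exact: open_nbhs_nbhs.
Qed.

Lemma ptws_coord_continuous (I : eqType) (i : I) :
  continuous (fun z : {ptws I -> R} => z i).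
Proof. exact: (@proj_continuous _ (fun _ : I => R) i). Qed.

(* Both maps are continuous on the ambient space, so that composing them needs no
   subspace topology. *)
Definition ambient_homeo (A B : set {ptws V -> R}) : Prop :=
  exists f g : {ptws V -> R} -> {ptws V -> R},
    [/\ continuous f, continuous g, forall x, A x -> B (f x) /\ g (f x) = x
      & forall y, B y -> A (g y) /\ f (g y) = y].

Lemma ambient_homeo_trans A B C :
  ambient_homeo A B -> ambient_homeo B C -> ambient_homeo A C.
Proof.
move=> [f [g [fc gc fg gf]]] [h [k [hc kc hk kh]]].
exists (h \o f), (g \o k); split.
- by move=> x; apply: continuous_comp; [exact: fc|exact: hc].
- by move=> x; apply: continuous_comp; [exact: kc|exact: gc].
- move=> x /fg[Bx E]; have [Cx E'] := hk _ Bx; split=> //=.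
  by rewrite E'.
- move=> x /kh[Bx E]; have [Cx E'] := gf _ Bx; split=> //=.
  by rewrite E'.
Qed.

Lemma ambient_homeomorphic A B : ambient_homeo A B -> homeomorphic A B.
Proof.
by move=> [f [g [fc gc fg gf]]]; exists f, g; split=> //; exact: continuous_subspaceT.
Qed.

Lemma homeomorphic_connected (X Y : topologicalType) (A : set X) (B : set Y) :
  homeomorphic A B -> connected A -> connected B.
Proof.
move=> [f [g [fc gc fg gf]]] cA; have -> : B = f @` A.
  rewrite eqEsubset; split=> [y /gf[Ay E]|_ [x /fg[Bx _] <-]] //.
  by exists (g y).
exact: connected_continuous_connected.
Qed.

Definition displace (phi : {ptws V -> R} -> R) (w : V -> R) z : {ptws V -> R} :=
  fun i => z i + phi z * w i.

Lemma displace_continuous phi w : continuous phi -> continuous (displace phi w).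
Proof.
move=> pc x; apply: ptws_continuous_at => i.
have zi : {for x, continuous (fun z : {ptws V -> R} => z i)} by exact: ptws_coord_continuous.
have pw : {for x, continuous (fun z : {ptws V -> R} => phi z * w i)}.
  by apply: (@continuousM _ _ phi (fun=> w i) x); [exact: pc|exact: cst_continuous].
exact: (continuousD zi pw).
Qed.

(** The two maps push along the same vector [w], so they cancel as soon as the amount of the second,
    taken at the image, is minus the amount of the first. *)
Lemma ambient_homeo_displace A B phi psi w : continuous phi -> continuous psi ->
  (forall z, A z -> B (displace phi w z) /\ psi (displace phi w z) = - phi z) ->
  (forall z, B z -> A (displace psi w z) /\ phi (displace psi w z) = - psi z) ->
  ambient_homeo A B.
Proof.
move=> pc qc AB BA; exists (displace phi w), (displace psi w).
split; try exact: displace_continuous.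
  move=> z /AB[Bz E]; split=> //; apply/funext => i.
  by rewrite [LHS]/displace E /displace mulNr addrK.
move=> z /BA[Bz E]; split=> //; apply/funext => i.
by rewrite [LHS]/displace E /displace mulNr addrK.
Qed.

Lemma min_coord_continuous (i j : V) :
  continuous (fun z : {ptws V -> R} => Num.min (z i) (z j)).
Proof.
by move=> z; apply: (@continuous_min R _ (fun z => z i) (fun z => z j));
  exact: ptws_coord_continuous.
Qed.

Lemma min0P (s t : R) : 0 <= s -> 0 <= t ->
  reflect (s = 0 \/ t = 0) (Num.min s t == 0).
Proof.
move=> s0 t0; apply: (iffP eqP) => [|[]->].
- by rewrite minEle; case: ifP => _; [left|right].
- by rewrite min_l.
- by rewrite min_r.
Qed.

Lemma realization_face F z i : realization R F z -> z i != 0 ->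
  exists2 f, f \in F & i \in f.
Proof. by move=> [_ _ [s sF sz]] zi; exists s => //; exact: sz. Qed.

Lemma min_nonadj F z (a m : V) : a != m -> ~~ adj F a m -> realization R F z ->
  Num.min (z a) (z m) = 0.
Proof.
move=> am nam [z0 _ [s sF sz]]; apply/eqP/min0P => //.
have [|za] := eqVneq (z a) 0; first by left.
have [|zm] := eqVneq (z m) 0; first by right.
case/negP: nam; rewrite /adj am; apply/existsP; exists s.
by rewrite sF !sz.
Qed.

Definition ind (i j : V) : R := (i == j)%:R.

Lemma indxx i : ind i i = 1.
Proof. by rewrite /ind eqxx. Qed.

Lemma ind_neq i j : i != j -> ind i j = 0.
Proof. by rewrite /ind => /negbTE ->. Qed.

Lemma sum_ind (i : V) : \sum_j ind i j = 1.
Proof.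
rewrite (bigD1 i) //= /ind eqxx big1 ?addr0 // => j ji.
by rewrite eq_sym (negbTE ji).
Qed.

(* The flip realizes the affine dependency a + m = c + y of the quadrilateral acmy
   with diagonals cy and am. *)
Definition flip_weight (a c y m i : V) : R := ind a i + ind m i - ind c i - ind y i.

(** The displacement annuls the smaller of the coordinates at [c] and [y], so a point of the
    quadrilateral lands in [aym] or in [acm]. Any other point lies in a face without the edge [cy],
    where the minimum is 0, and stays put. *)
Lemma flip_realization F (a c y m : V) z :
  (forall u, [set c; y; u]%SET \in F -> u = a \/ u = m) ->
  triples F -> [set a; c; y]%SET \in F -> [set c; y; m]%SET \in F ->
  a != m -> ~~ adj F a m -> realization R F z ->
  realization R (flip F a c y m)
    (displace (fun z => Num.min (z c) (z y)) (flip_weight a c y m) z).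
Proof.
move=> cyF t3 acy cym am nam Fz; have [z0 z1 [s sF sz]] := Fz.
have [ac ay cy] := set3_face t3 acy; have [_ cm ym] := set3_face t3 cym.
pose mu := Num.min (z c) (z y); set g := displace _ _ z.
have mu0 : 0 <= mu by rewrite le_min !z0.
have gE i : g i = z i + mu * flip_weight a c y m i by [].
have [ma ca ya] : [/\ m != a, c != a & y != a] by split; rewrite eq_sym.
have [mc my yc] : [/\ m != c, m != y & y != c] by split; rewrite eq_sym.
have ga : g a = z a + mu.
  by rewrite gE /flip_weight indxx !ind_neq // addr0 !subr0 mulr1.
have gm : g m = z m + mu.
  by rewrite gE /flip_weight indxx !ind_neq // add0r !subr0 mulr1.
have gc : g c = z c - mu.
  by rewrite gE /flip_weight indxx !ind_neq // addr0 sub0r subr0 mulrN1.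
have gy : g y = z y - mu.
  by rewrite gE /flip_weight indxx !ind_neq // addr0 subr0 sub0r mulrN1.
have go i : i != a -> i != c -> i != y -> i != m -> g i = z i.
  by move=> *; rewrite gE /flip_weight !ind_neq 1?eq_sym // addr0 !subr0 mulr0 addr0.
have gcy : g c = 0 \/ g y = 0.
  rewrite gc gy /mu minEle; case: ifP => _; [left|right]; exact: subrr.
split.
- move=> i; have [->|ia] := eqVneq i a; first by rewrite ga addr_ge0.
  have [->|im] := eqVneq i m; first by rewrite gm addr_ge0.
  have [->|ic] := eqVneq i c; first by rewrite gc subr_ge0 ge_min lexx.
  have [->|iy] := eqVneq i y; first by rewrite gy subr_ge0 ge_min lexx orbT.
  by rewrite go.
- rewrite /g /displace big_split /= z1 -mulr_sumr -[RHS]addr0; congr (_ + _).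
  by rewrite /flip_weight !sumrB big_split /= !sum_ind addrK subrr mulr0.
case: (boolP ((s == [set a; c; y]%SET) || (s == [set c; y; m]%SET))) => [sE|].
  have gs i : g i != 0 -> [|| i == a, i == c, i == y | i == m].
    have [//|ia] := eqVneq i a; have [//|ic] := eqVneq i c.
    have [//|iy] := eqVneq i y; have [//|im] := eqVneq i m.
    rewrite go // => /sz; case/orP: sE => /eqP->; rewrite !inE.
      by rewrite (negbTE ia) (negbTE ic) (negbTE iy).
    by rewrite (negbTE ic) (negbTE iy) (negbTE im).
  case: gcy => g0.
    exists [set a; y; m]%SET => [|i gi]; first by rewrite flipE eqxx orbT.
    have := gs _ gi; rewrite !inE; case: (eqVneq i c) gi => [->|_ _].
      by rewrite g0 eqxx.
    by rewrite -!orbA.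
  exists [set a; c; m]%SET => [|i gi]; first by rewrite flipE eqxx !orbT.
  have := gs _ gi; rewrite !inE; case: (eqVneq i y) gi => [->|_ _].
    by rewrite g0 eqxx.
  by rewrite -!orbA.
rewrite negb_or => /andP[s1 s2]; have muE : mu = 0.
  apply/eqP/min0P => //; have [|zc] := eqVneq (z c) 0; first by left.
  have [|zy] := eqVneq (z y) 0; first by right.
  have [u [w E]] := face3 t3 sF (sz _ zc).
  have ys := sz _ zy; have [u' E'] : exists u', s = [set c; y; u']%SET.
    move: ys; rewrite E !inE eq_sym (negbTE cy) /= => /orP[]/eqP->.
      by exists w.
    by exists u; rewrite set3C.
  move: sF s1 s2; rewrite E' => /cyF[]->; last by rewrite eqxx.
  by rewrite (set3_rot a c y) eqxx.
have gz : g = z by apply/funext=> i; rewrite gE muE mul0r addr0.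
by exists s => [|i]; rewrite ?flipE ?sF ?s1 ?s2 // gz; exact: sz.
Qed.

End Shifts.

(** * The two moves as homeomorphisms, and the contraction of an edge as a chain of moves *)

Section Contraction.

Local Open Scope classical_set_scope.
Local Open Scope ring_scope.

Variables (R : realType) (V : finType).
Implicit Types (F : {set {set V}}) (a c x y m u v : V) (z : {ptws V -> R}).

Lemma edge_faces F a c y m u : has_links F ->
  [set a; c; y]%SET \in F -> [set c; y; m]%SET \in F -> a != m ->
  [set c; y; u]%SET \in F -> u = a \/ u = m.
Proof.
move=> hl acy cym am; have cay : [set c; a; y]%SET \in F by rewrite set3CA.
have [s [us _ Hl]] := link_edge2 hl cay cym am.
have ur : uniq (rcons [:: y, m & s] a) by rewrite -rot1_cons rot_uniq.
rewrite Hl -(cyc_rot 1 us) rot1_cons rcons_cons cyc_head //= last_rcons.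
by case/orP=> /eqP; [right|left].
Qed.

(** Nonadjacent [a] and [m] are never both in the support, so the smaller of their coordinates rises
    from 0 to exactly the amount of the displacement. This is how the inverse recovers that
    amount. *)
Lemma flip_half F a c y m z : triples F -> has_links F ->
  [set a; c; y]%SET \in F -> [set c; y; m]%SET \in F -> a != m -> ~~ adj F a m ->
  realization R F z ->
  let z' := displace (fun z => Num.min (z c) (z y)) (flip_weight R a c y m) z in
  realization R (flip F a c y m) z' /\ Num.min (z' a) (z' m) = Num.min (z c) (z y).
Proof.
move=> t3 hl acy cym am nam Fz z'; split.
  by apply: flip_realization => // u; exact: edge_faces.
have [ac ay cy] := set3_face t3 acy; have [_ cm ym] := set3_face t3 cym.
have [ma ca ya] : [/\ m != a, c != a & y != a] by split; rewrite eq_sym.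
rewrite /z' /displace /flip_weight !indxx !ind_neq // addr0 add0r !subr0 mulr1.
by rewrite -addr_minl (min_nonadj am nam Fz) add0r.
Qed.

Lemma flip_nonadj F a c y m : triples F -> has_links F ->
  [set a; c; y]%SET \in F -> [set c; y; m]%SET \in F -> a != m -> ~~ adj F a m ->
  ~~ adj (flip F a c y m) y c.
Proof.
move=> t3 hl acy cym am nam.
have [ac ay cy] := set3_face t3 acy; have [_ cm ym] := set3_face t3 cym.
have t3' := flip_triples t3 acy cym am.
apply/(adjP _ _ t3') => -[u]; rewrite flipE => /or3P[/and3P[H h1 h2]|/eqP E|/eqP E].
- rewrite set3CA in H; case: (edge_faces hl acy cym am H) h1 h2 => ->.
    by rewrite -set3_rot set3C eqxx.
  by rewrite (set3CA y c m) eqxx.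
- have : c \in [set a; y; m]%SET by rewrite -E !inE eqxx orbT.
  by rewrite !inE eq_sym (negbTE ac) (negbTE cy) (negbTE cm).
have : y \in [set a; c; m]%SET by rewrite -E !inE eqxx.
by rewrite !inE eq_sym (negbTE ay) eq_sym (negbTE cy) (negbTE ym).
Qed.

(** The reverse flip has old diagonal [am] and new diagonal [yc]. Nonadjacency of [a] and [m]
    ensures that the two faces it deletes were not already in [F]. *)
Lemma flip_flip F a c y m : triples F ->
  [set a; c; y]%SET \in F -> [set c; y; m]%SET \in F -> ~~ adj F a m ->
  flip (flip F a c y m) y a m c = F.
Proof.
move=> t3 acy cym nam; apply/setP=> f; rewrite !flipE.
rewrite (set3CA y a m) (set3C a m c) (set3_rot y m c) (set3_rot m c y).
rewrite (set3_rot y a c).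
have aym : [set a; y; m]%SET \notin F.
  by apply: contra nam => H; apply/adjP => //; exists y; rewrite set3C.
have acm : [set a; c; m]%SET \notin F.
  by apply: contra nam => H; apply/adjP => //; exists c; rewrite set3C.
have [->|n1] := eqVneq f [set a; c; y]%SET; first by rewrite acy !orbT.
have [->|n2] := eqVneq f [set c; y; m]%SET; first by rewrite cym !orbT.
have [->|n3] := eqVneq f [set a; y; m]%SET; first by rewrite (negbTE aym).
have [->|n4] := eqVneq f [set a; c; m]%SET; first by rewrite (negbTE acm).
by rewrite !andbT !orbF.
Qed.

Lemma flip_homeo F a c y m : triples F -> has_links F ->
  [set a; c; y]%SET \in F -> [set c; y; m]%SET \in F -> a != m -> ~~ adj F a m ->
  ambient_homeo (realization R F) (realization R (flip F a c y m)).
Proof.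
move=> t3 hl acy cym am nam.
have [ac ay cy] := set3_face t3 acy; have [_ cm ym] := set3_face t3 cym.
have t3' := flip_triples t3 acy cym am.
have hl' := flip_links t3 hl acy cym am nam.
have nyc := flip_nonadj t3 hl acy cym am nam.
have yam : [set y; a; m]%SET \in flip F a c y m.
  by rewrite flipE (set3CA y a m) eqxx orbT.
have amc : [set a; m; c]%SET \in flip F a c y m.
  by rewrite flipE (set3C a m c) eqxx !orbT.
have yc : y != c by rewrite eq_sym.
pose psi z : R := - Num.min (z a) (z m).
(* The weight of the reverse flip is the opposite vector, so the inverse is the forward map of the
   reverse flip and [flip_half] covers both directions. *)
have psiE z : displace psi (flip_weight R a c y m) z =
    displace (fun z => Num.min (z a) (z m)) (flip_weight R y a m c) z.
  apply/funext => i; rewrite /displace /psi mulNr -mulrN; congr (_ + _ * _).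
  by rewrite /flip_weight !opprB opprD; ring.
apply: (@ambient_homeo_displace _ _ _ _ (fun z => Num.min (z c) (z y)) psi
  (flip_weight R a c y m)).
- exact: min_coord_continuous.
- by move=> z; exact: (continuousN (@min_coord_continuous R V a m z)).
- move=> z Fz; have [H E] := flip_half t3 hl acy cym am nam Fz.
  by split=> //; exact: (congr1 -%R E).
move=> z Fz; rewrite psiE.
have [] := flip_half t3' hl' yam amc yc nyc Fz.
rewrite flip_flip // => H E; split=> //.
by rewrite /psi opprK -[RHS]E minC.
Qed.

(** The affine dependency 3c = a + x + y, which places [c] at the barycentre of the triangle
    [axy]. *)
Definition remove_weight a c x y (i : V) : R :=
  ind R a i + ind R x i + ind R y i - 3 * ind R c i.

Lemma min3_continuous a x y :
  continuous (fun z : {ptws V -> R} => Num.min (z a) (Num.min (z x) (z y))).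
Proof.
move=> z; apply: (@continuous_min R _ (fun z => z a) (fun z => Num.min (z x) (z y))).
  exact: (@ptws_coord_continuous R V a z).
exact: (@min_coord_continuous R V x y z).
Qed.

(** Forward, the coordinate at [c] is shared in thirds among [a], [x], [y]. Backward, a point of
    [axy] gives up equal amounts until one of its three coordinates vanishes, which selects the face
    at [c] where it lands. As [axy] is not a face of [F], the least of these coordinates is 0 before
    the forward move and equals the amount after it. *)
Lemma remove3_homeo F a c x y : triples F -> has_links F ->
  link F c [:: a; x; y] -> [set a; x; y]%SET \notin F ->
  ambient_homeo (realization R F) (realization R (remove3 F a c x y)).
Proof.
move=> t3 hl L naxy.
have cn := remove3_vertices t3 L.
have := link_notin t3 L; have [ul _ Hl] := L.
move: (ul); rewrite /= !in_cons !in_nil !orbF !negb_or !andbT.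
case/andP=> /andP[ax ay] xy /and3P[ca cx cy].
have cax : [set c; a; x]%SET \in F by rewrite Hl cyc_cons3 upair_refl.
have cxy : [set c; x; y]%SET \in F by rewrite Hl cyc_cons3 upair_refl orbT.
have cay : [set c; a; y]%SET \in F by rewrite Hl cyc_head //= eqxx orbT.
pose w := remove_weight a c x y.
have w0 : \sum_i w i = 0.
  by rewrite /w /remove_weight sumrB !big_split /= -mulr_sumr !sum_ind; ring.
have [ac xc yc] : [/\ a != c, x != c & y != c] by split; rewrite eq_sym.
have [xa ya yx] : [/\ x != a, y != a & y != x] by split; rewrite eq_sym.
have wc : w c = - 3 by rewrite /w /remove_weight indxx !ind_neq //; ring.
have wa : w a = 1 by rewrite /w /remove_weight indxx !ind_neq //; ring.
have wx : w x = 1 by rewrite /w /remove_weight indxx !ind_neq //; ring.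
have wy : w y = 1 by rewrite /w /remove_weight indxx !ind_neq //; ring.
have wo i : i != a -> i != c -> i != x -> i != y -> w i = 0.
  by move=> *; rewrite /w /remove_weight !ind_neq 1?eq_sym //; ring.
have sum_displace phi z : \sum_i z i = 1 -> \sum_i displace phi w z i = 1.
  by move=> z1; rewrite /displace big_split /= z1 -mulr_sumr w0 mulr0 addr0.
pose psi z : R := - Num.min (z a) (Num.min (z x) (z y)).
apply: (@ambient_homeo_displace _ _ _ _ (fun z => z c / 3) psi w).
- move=> z; apply: (@continuousM _ _ (fun z => z c) (fun=> 3^-1) z).
    exact: (@ptws_coord_continuous R V c z).
  exact: cst_continuous.
- by move=> z; exact: (continuousN (@min3_continuous a x y z)).
- move=> z [z0 z1 [s sF sz]]; set t := z c / 3; set g := displace _ _ _.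
  have gE i : g i = z i + t * w i by [].
  have t0 : 0 <= t by rewrite divr_ge0.
  have gc : g c = 0 by rewrite gE wc /t; field.
  have ga : g a = z a + t by rewrite gE wa mulr1.
  have gx : g x = z x + t by rewrite gE wx mulr1.
  have gy : g y = z y + t by rewrite gE wy mulr1.
  have go i : i != a -> i != c -> i != x -> i != y -> g i = z i.
    by move=> *; rewrite gE wo // mulr0 addr0.
  have m0 : Num.min (z a) (Num.min (z x) (z y)) = 0.
    apply/eqP/min0P; rewrite ?le_min ?z0 //.
    have [|za] := eqVneq (z a) 0; [by left|right]; apply/eqP/min0P => //.
    have [|zx] := eqVneq (z x) 0; [by left|right].
    have [//|zy] := eqVneq (z y) 0; case/negP: naxy.
    by rewrite -(card3_set3 (t3 s sF) (sz _ za) (sz _ zx) (sz _ zy)).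
  split; last first.
    by rewrite /psi ga gx gy -!addr_minl m0 add0r.
  split; last 1 first.
  + have [cs|cs] := boolP (c \in s); last first.
      have zc : z c = 0 by apply/eqP; apply: contraNT cs; exact: sz.
      exists s => [|i]; last first.
        by rewrite gE /t zc mul0r mul0r addr0; exact: sz.
      rewrite remove3E sF /=; apply/orP; left.
      by apply/and3P; split; apply: contraNneq cs => ->; rewrite !inE eqxx.
    exists [set a; x; y]%SET => [|i gi]; first by rewrite remove3E eqxx orbT.
    rewrite !inE; have [//|ia] := eqVneq i a; have [//|ix] := eqVneq i x.
    have [//|iy] := eqVneq i y; move: gi; have [->|ic] := eqVneq i c.
      by rewrite gc eqxx.
    rewrite go // => /sz.
    by case: (remove3_faces t3 L sF cs) => ->; rewrite !inE
      ?(negbTE ia) ?(negbTE ix) ?(negbTE iy) (negbTE ic).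
  + move=> i; have [->|ia] := eqVneq i a; first by rewrite ga addr_ge0.
    have [->|ix] := eqVneq i x; first by rewrite gx addr_ge0.
    have [->|iy] := eqVneq i y; first by rewrite gy addr_ge0.
    by have [->|ic] := eqVneq i c; rewrite ?gc ?go.
  + exact: sum_displace.
move=> z Fz; have [z0 z1 [s sF sz]] := Fz; set g := displace _ _ _.
pose t := Num.min (z a) (Num.min (z x) (z y)).
have gE i : g i = z i - t * w i by rewrite /g /displace /psi mulNr.
have t0 : 0 <= t by rewrite !le_min !z0.
have zc : z c = 0.
  apply/eqP; apply: contraNT cn => zc; have [f fF cf] := realization_face Fz zc.
  by apply/mem_vertices; exists f.
have gc : g c = 3 * t by rewrite gE wc zc; ring.
have ga : g a = z a - t by rewrite gE wa mulr1.
have gx : g x = z x - t by rewrite gE wx mulr1.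
have gy : g y = z y - t by rewrite gE wy mulr1.
have go i : i != a -> i != c -> i != x -> i != y -> g i = z i.
  by move=> *; rewrite gE wo // mulr0 subr0.
split; last by rewrite gc /psi -/t opprK; field.
split; last 1 first.
- move: sF; rewrite remove3E => /orP[/and4P[sF _ _ _]|/eqP sE]; last first.
    have gs i : g i != 0 -> [|| i == a, i == x, i == y | i == c].
      have [//|ia] := eqVneq i a; have [//|ix] := eqVneq i x.
      have [//|iy] := eqVneq i y; have [//|ic] := eqVneq i c.
      rewrite go // => /sz; rewrite sE !inE.
      by rewrite (negbTE ia) (negbTE ix) (negbTE iy).
    have [e|[e|e]] : g a = 0 \/ g x = 0 \/ g y = 0.
      rewrite ga gx gy /t ![Num.min _ _]minEle.
      by case: ifP => _; [left|right; case: ifP => _; [left|right]]; exact: subrr.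
    + exists [set c; x; y]%SET => // i gi; move: (gs i gi); rewrite !inE.
      by case: (eqVneq i a) gi => [->|_ _]; [rewrite e eqxx|do 3!case: eqP].
    + exists [set c; a; y]%SET => // i gi; move: (gs i gi); rewrite !inE.
      by case: (eqVneq i x) gi => [->|_ _]; [rewrite e eqxx|do 3!case: eqP].
    exists [set c; a; x]%SET => // i gi; move: (gs i gi); rewrite !inE.
    by case: (eqVneq i y) gi => [->|_ _]; [rewrite e eqxx|do 3!case: eqP].
  have tE : t = 0.
    apply/eqP/min0P; rewrite ?le_min ?z0 //.
    have [|za] := eqVneq (z a) 0; [by left|right]; apply/eqP/min0P => //.
    have [|zx] := eqVneq (z x) 0; [by left|right].
    have [//|zy] := eqVneq (z y) 0; case/negP: naxy.
    by rewrite -(card3_set3 (t3 s sF) (sz _ za) (sz _ zx) (sz _ zy)).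
  by exists s => // i; rewrite gE tE mul0r subr0; exact: sz.
- move=> i; have [->|ia] := eqVneq i a; first by rewrite ga subr_ge0 ge_min lexx.
  have [->|ix] := eqVneq i x; first by rewrite gx subr_ge0 !ge_min lexx orbT.
  have [->|iy] := eqVneq i y; first by rewrite gy subr_ge0 !ge_min lexx !orbT.
  have [->|ic] := eqVneq i c; first by rewrite gc mulr_ge0.
  by rewrite go.
exact: sum_displace.
Qed.

(** The vertices [y] and [last y q] are the neighbours of [a] in the link of [c]; that [a] is
    adjacent to no other vertex of this link says that [ac] is on no nonfacial 3-cycle. The excluded
    face would close the link of [a] to a triangle. Each induction step flips [cy] to [am], with [m]
    the head of [q]: this drops [y] from the link of [c], puts [m] in its place and keeps the last
    vertex. When [q] is a singleton, [c] has degree three. *)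
Lemma contract_homeo (q : seq V) F a c y : triples F -> has_links F ->
  link F c [:: a, y & q] ->
  (forall u, u \in q -> u != last y q -> ~~ adj F a u) ->
  [set a; y; last y q]%SET \notin F ->
  [/\ triples (contract_edge F a c), has_links (contract_edge F a c)
    & ambient_homeo (realization R F) (realization R (contract_edge F a c))].
Proof.
elim: q F y => [|m [|m' q] IH] F y t3 hl L nadj naxy; first by case: L.
  rewrite (contract_remove3 t3 L); split.
  - exact: remove3_triples.
  - exact: remove3_links.
  - exact: remove3_homeo.
have [ul _ Hl] := L.
have [am ml] : a != m /\ m != last m' q.
  move: ul; rewrite /= !in_cons !negb_or => /and4P[/and4P[_ -> _ _] _ /andP[mm mq] _].
  split=> //; apply/negP => /eqP E; have := mem_last m' q.
  by rewrite -E in_cons (negbTE mm) (negbTE mq).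
have nam : ~~ adj F a m by apply: nadj; rewrite ?mem_head.
have cay : [set c; a; y]%SET \in F by rewrite Hl cyc_cons3 upair_refl.
have acy : [set a; c; y]%SET \in F by rewrite set3CA.
have cym : [set c; y; m]%SET \in F by rewrite Hl cyc_cons3 upair_refl orbT.
have t3' := flip_triples t3 acy cym am.
have hl' := flip_links t3 hl acy cym am nam.
have L' := flip_link_delete t3 acy cym am nam L.
have cn := link_notin t3 L.
rewrite -(contract_flip t3 acy cym am).
have uneq u : u \in m' :: q -> [/\ a != u, u != c, u != y & u != m].
  move=> uq; split.
  - by apply: contraTneq ul => ->; rewrite /= 2!in_cons uq !orbT.
  - by apply: contraNneq cn => <-; rewrite 3!in_cons uq !orbT.
  - by apply: contraTneq ul => <-; rewrite /= (in_cons m) uq orbT andbF.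
  by apply: contraTneq ul => <-; rewrite /= uq !andbF.
have [] := IH (flip F a c y m) m t3' hl' L'.
- move=> u uq ul'; have [au uc uy um] := uneq u uq.
  have : ~~ adj F a u by apply: nadj => //; rewrite in_cons uq orbT.
  apply: contra; rewrite (adjC F) (adjC (flip _ _ _ _ _)); apply: flip_adj => //.
  by rewrite !inE !negb_or uc uy um.
(* The face to exclude is now [a], [m], [last m' q]: it is not in [F], where [a] and [m] are not
   adjacent, and neither new face contains the last vertex. *)
- have [al lc ly lm] := uneq _ (mem_last m' q).
  have [ac ay cy] := set3_face t3 acy; have [_ cm ym] := set3_face t3 cym.
  rewrite /= flipE; apply/or3P; case.
  + case/and3P=> H _ _; case/negP: nam; apply/adjP=> //.
    by exists (last m' q).
  + by rewrite set3C set3_eq // /upair (negbTE ly) (negbTE lm).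
  + by rewrite set3C set3_eq // /upair (negbTE lc) (negbTE lm).
move=> Ct Cl Ch; split=> //; apply: ambient_homeo_trans Ch.
exact: flip_homeo.
Qed.

End Contraction.

(** * Connectedness *)

Section Connectivity.

Local Open Scope classical_set_scope.
Local Open Scope ring_scope.

Variables (R : realType) (V : finType).
Implicit Types (F : {set {set V}}) (a c x y m u v : V) (z : {ptws V -> R}).

Lemma realization_ind F x : x \in vertices F -> realization R F (ind R x).
Proof.
move=> /mem_vertices[f fF xf]; split=> [i||]; rewrite ?sum_ind ?ler0n //.
by exists f => // i; have [<- //|xi] := eqVneq x i; rewrite ind_neq // eqxx.
Qed.

Lemma sum_coord_continuous (A : {set V}) :
  continuous (fun z : {ptws V -> R} => \sum_(i in A) z i).
Proof.
pose f (s : seq V) z : R := \sum_(i <- s) z i.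
suff fc s : continuous (f s).
  have -> // : (fun z : {ptws V -> R} => \sum_(i in A) z i) = f (enum A).
  by apply/funext => z; rewrite /f big_enum.
elim: s => [|i s IH] z.
  have -> : f [::] = fun=> 0 by apply/funext => y; rewrite /f big_nil.
  exact: cst_continuous.
have -> : f (i :: s) = fun z => z i + f s z.
  by apply/funext => y; rewrite /f big_cons.
exact: (continuousD (@ptws_coord_continuous R V i z) (IH z)).
Qed.

(** The total weight that a point puts on [A] is continuous, and it is 0 or 1 because a face meeting
    [A] lies in [A]. A vertex outside [A] would give both values, and connectedness then also the
    value 1/2. *)
Lemma connected_vertices F (A : {set V}) x : connected (realization R F) ->
  (forall u y, u \in A -> adj F u y -> y \in A) ->
  x \in A -> x \in vertices F -> {subset vertices F <= A}.
Proof.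
move=> cF Aadj xA xF y yF; apply: contraT => yA.
pose h z : R := \sum_(i in A) z i.
have : connected (h @` realization R F).
  apply: connected_continuous_connected => //; apply: continuous_subspaceT.
  exact: sum_coord_continuous.
move/connected_intervalP => H.
have h1 : (h @` realization R F) 1.
  exists (ind R x); first exact: realization_ind.
  rewrite /h (bigD1 x) //= indxx big1 ?addr0 // => i /andP[_ ix].
  by rewrite ind_neq // eq_sym.
have h0 : (h @` realization R F) 0.
  exists (ind R y); first exact: realization_ind.
  by rewrite /h big1 // => i iA; rewrite ind_neq //; apply: contraNneq yA => ->.
have [z [z0 z1 [s sF sz]] hz] : (h @` realization R F) 2^-1.
  by apply: (H _ _ h0 h1); rewrite invr_ge0 ler0n invf_le1 ?ler1n ?ltr0n.
have [[u us uA]|nA] : (exists2 u, u \in s & u \in A) \/ (forall u, u \in s -> u \notin A).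
  case: (pickP [pred u | (u \in s) && (u \in A)]) => [u /= /andP[us uA]|N].
    by left; exists u.
  by right=> u us; apply/negP => uA; have := N u; rewrite /= us uA.
  have sA i : i \in s -> i \in A.
    move=> is_; have [->//|ui] := eqVneq i u; apply: (Aadj u) => //.
    by rewrite /adj eq_sym ui; apply/existsP; exists s; rewrite sF us.
  have : h z = 1.
    rewrite -z1 /h big_mkcond; apply: eq_bigr => i _; case: ifPn => // iA.
    by apply/esym/eqP; apply: contraNT iA => /sz /sA.
  by rewrite hz => /eqP; rewrite invr_eq1 pnatr_eq1.
have : h z = 0.
  rewrite /h big1 // => i iA; apply/eqP; apply: contraTT iA => /sz; exact: nA.
by rewrite hz => /eqP; rewrite invr_eq0 pnatr_eq0.
Qed.

Lemma segment_component (B : set {ptws V -> R}) (x y : {ptws V -> R}) :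
  (forall t, 0 <= t -> t <= 1 -> B (fun i => (1 - t) * x i + t * y i)) ->
  connected_component B x y.
Proof.
move=> H; pose h (t : R) : {ptws V -> R} := fun i => (1 - t) * x i + t * y i.
have hc : continuous h.
  move=> t; apply: ptws_continuous_at => i; rewrite /h.
  have cc (s : R) : {for t, continuous (fun _ : R => s)} by exact: cst_continuous.
  have ci : {for t, continuous (fun s : R => s)} by move=> A.
  have c1 : {for t, continuous (fun s : R => 1 - s)} by exact: (continuousB (cc 1) ci).
  exact: (continuousD (continuousM c1 (cc (x i))) (continuousM ci (cc (y i)))).
have D : connected (h @` `[0, 1]).
  apply: connected_continuous_connected; first exact: segment_connected.
  exact: continuous_subspaceT.
have hx : (h @` `[0, 1]) x.
  exists 0; first by rewrite /= in_itv /= lexx ler01.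
  by apply/funext=> i; rewrite /h subr0 mul1r mul0r addr0.
have hy : (h @` `[0, 1]) y.
  exists 1; first by rewrite /= in_itv /= lexx ler01.
  by apply/funext=> i; rewrite /h subrr mul0r mul1r add0r.
apply: (connected_component_max hx) => // _ [t /= + <-].
by rewrite in_itv /= => /andP[t0 t1]; exact: H.
Qed.

Definition off_rel F (C : {set V}) : rel V :=
  fun x y => [&& adj F x y, x \notin C & y \notin C].

(** A point off the curve has a nonzero coordinate at some vertex outside the cycle: since [abc] is
    not a face, a point supported on [a], [b], [c] has a zero among these coordinates and lies on
    the curve. The segment to that vertex keeps this coordinate positive, hence avoids the curve,
    and so do the edges between vertices outside the cycle. *)
Lemma connected_off_curve F a b c (x0 : V) :
  [set a; b; c]%SET \notin F -> triples F -> cycle3 F a b c ->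
  x0 \in vertices F -> x0 \notin [set a; b; c]%SET ->
  (forall y, y \in vertices F -> y \notin [set a; b; c]%SET ->
     connect (off_rel F [set a; b; c]%SET) x0 y) ->
  connected (realization R F `\` curve3 R a b c).
Proof.
set C := [set a; b; c]%SET => nabc t3 /and3P[ab bc ac] x0F x0C H.
set B := _ `\` _.
have inB z i : realization R F z -> z i != 0 -> i \notin C -> B z.
  move=> Fz zi iC; split=> // -[_ _ [s + /(_ _ zi)]].
  by rewrite !inE => /orP[/orP[]|] /eqP->; rewrite !inE => /orP[]/eqP E;
    move: iC; rewrite E !inE eqxx ?orbT.
have Bind x : x \in vertices F -> x \notin C -> B (ind R x).
  move=> xF xC; apply: (inB _ x) => //; first exact: realization_ind.
  by rewrite indxx oner_neq0.
have step x y : off_rel F C x y -> connected_component B (ind R x) (ind R y).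
  case/and3P => xy xC yC; apply: segment_component => t t0 t1.
  have s0 : 0 <= 1 - t by rewrite subr_ge0.
  have nxy : x != y by case/andP: xy.
  have nyx : y != x by rewrite eq_sym.
  have Fz : realization R F (fun i => (1 - t) * ind R x i + t * ind R y i).
    split=> [i||].
    - by rewrite addr_ge0 // mulr_ge0 // ler0n.
    - by rewrite big_split /= -!mulr_sumr !sum_ind !mulr1 subrK.
    case/andP: xy => _ /existsP[f /andP[fF /andP[xf yf]]]; exists f => // i.
    have [<- //|nx] := eqVneq x i; have [<- //|ny] := eqVneq y i.
    by rewrite !ind_neq // !mulr0 addr0 eqxx.
  have [t00|tn] := eqVneq t 0.
    apply: (inB _ x) => //; rewrite indxx (ind_neq _ nyx) t00 subr0 mul1r mulr0 addr0.
    exact: oner_neq0.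
  by apply: (inB _ y) => //; rewrite indxx ind_neq // mulr0 add0r mulr1.
have comp y : y \in vertices F -> y \notin C -> connected_component B (ind R x0) (ind R y).
  move=> yF yC; have /connectP[p pp ->] := H y yF yC.
  have {x0C x0F} B0 := Bind _ x0F x0C.
  elim: p x0 {H} B0 pp => [|y' p IH] x B0 /=.
    by move=> _; exact: connected_component_refl.
  case/andP=> xy' pp; apply: (connected_component_trans (step _ _ xy')).
  apply: IH => //; case/and3P: xy' => xy' _; apply: Bind.
  exact: adj_vertices xy'.
have all z : B z -> connected_component B (ind R x0) z.
  move=> Bz; have [[z0 z1 [s sF sz]] nC] := Bz.
  have [i zi iC] : exists2 i, z i != 0 & i \notin C.
    case: (pickP [pred i | (z i != 0) && (i \notin C)]) => [i /= /andP[]|N].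
      by exists i.
    case: nC; split=> //.
    have sC i : z i != 0 -> i \in C.
      by move=> zi; have := N i; rewrite /= zi /=; case: (i \in C).
    have [za|za] := eqVneq (z a) 0.
      exists [set b; c]%SET => [|i zi]; first by rewrite !inE eqxx orbT.
      have := sC i zi; rewrite !inE -orbA; case: (eqVneq i a) zi => //= ->.
      by rewrite za eqxx.
    have [zb|zb] := eqVneq (z b) 0.
      exists [set a; c]%SET => [|i zi]; first by rewrite !inE eqxx orbT.
      have := sC i zi; rewrite !inE; case: (eqVneq i b) zi => [->|]; first by rewrite zb eqxx.
      by rewrite orbF.
    have [zc|zc] := eqVneq (z c) 0.
      exists [set a; b]%SET => [|i zi]; first by rewrite !inE eqxx.
      have := sC i zi; rewrite !inE; case: (eqVneq i c) zi => [->|]; first by rewrite zc eqxx.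
      by rewrite orbF.
    case/negP: nabc; rewrite /C -(card3_set3 (t3 s sF) (sz _ za) (sz _ zb) (sz _ zc)) //.
    - by case/andP: ab.
    - by case/andP: ac.
    - by case/andP: bc.
  have iF : i \in vertices F by apply/mem_vertices; exists s => //; exact: sz.
  apply: (connected_component_trans (comp i iF iC)).
  apply/connected_component_sym/segment_component => t t0 t1.
  have s0 : 0 <= 1 - t by rewrite subr_ge0.
  apply: (inB _ i) => //.
    split=> [j||].
    - by rewrite addr_ge0 // mulr_ge0 // ler0n.
    - by rewrite big_split /= -!mulr_sumr sum_ind z1 !mulr1 subrK.
    exists s => // j; have [<- _|ij] := eqVneq i j; first exact: sz.
    by rewrite ind_neq // mulr0 addr0 mulf_eq0 negb_or => /andP[_ /sz].
  rewrite indxx mulr1; have zi0 : 0 < z i by rewrite lt_def zi z0.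
  have [->|t1'] := eqVneq t 1; first by rewrite subrr mul0r add0r oner_neq0.
  by rewrite gt_eqF // ltr_wpDr // mulr_gt0 // subr_gt0 lt_def eq_sym t1' t1.
have -> : B = connected_component B (ind R x0).
  by rewrite eqEsubset; split=> // ; exact: connected_component_sub.
exact: component_connected.
Qed.

End Connectivity.

(** * The tetrahedron *)

Section Tetrahedron.

Local Open Scope classical_set_scope.
Local Open Scope ring_scope.

Variables (R : realType) (V : finType) (a b c d : V).
Hypotheses (ab : a != b) (ac : a != c) (ad : a != d).
Hypotheses (bc : b != c) (bd : b != d) (cd : c != d).

Let i0 : 'I_3 := ord0.
Let i1 : 'I_3 := lift ord0 ord0.
Let i2 : 'I_3 := lift ord0 (lift ord0 ord0).

Let ord3P (i : 'I_3) : [\/ i = i0, i = i1 | i = i2].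
Proof.
by case: i => -[|[|[|//]]] ?; [constructor 1|constructor 2|constructor 3]; apply/val_inj.
Qed.

Definition tetrahedron : {set {set V}} :=
  [set [set a; b; c]; [set a; b; d]; [set a; c; d]; [set b; c; d]]%SET.

Lemma mem_tetrahedron (f : {set V}) : (f \in tetrahedron) =
  [|| f == [set a; b; c]%SET, f == [set a; b; d]%SET, f == [set a; c; d]%SET
    | f == [set b; c; d]%SET].
Proof. by rewrite !inE -!orbA. Qed.

Let corner (i : 'I_3) : V := nth d [:: a; b; c] i.

(** The affine map that sends [a], [b], [c] to the unit vectors and [d] to (-1, -1, -1), hence the
    barycentre to the origin; [to_sphere] follows it by radial projection. *)
Let offset (z : {ptws V -> R}) : {ptws 'I_3 -> R} := fun i => z (corner i) - z d.

Let offsetE z : [/\ offset z i0 = z a - z d, offset z i1 = z b - z d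
  & offset z i2 = z c - z d].
Proof. by []. Qed.

Let radius (u : {ptws 'I_3 -> R}) : R := Num.sqrt (u i0 ^+ 2 + u i1 ^+ 2 + u i2 ^+ 2).

Let low (u : {ptws 'I_3 -> R}) : R := Num.min 0 (Num.min (u i0) (Num.min (u i1) (u i2))).

(** The normalizing constant of [of_sphere]: [low u] is subtracted at all four vertices, where [d]
    starts from 0. *)
Let mass (u : {ptws 'I_3 -> R}) : R := u i0 + u i1 + u i2 - 4 * low u.

Let to_sphere (z : {ptws V -> R}) : {ptws 'I_3 -> R} :=
  fun i => offset z i / radius (offset z).

(* Subtracting low u makes the least of the four coordinates vanish. *)
Let of_sphere (u : {ptws 'I_3 -> R}) : {ptws V -> R} := fun i =>
  ((u i0 - low u) * ind R a i + (u i1 - low u) * ind R b i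
   + (u i2 - low u) * ind R c i - low u * ind R d i) / mass u.

Let low_le u : [/\ low u <= 0, low u <= u i0, low u <= u i1 & low u <= u i2].
Proof. by rewrite /low !ge_min !lexx !orbT. Qed.

Let low_attained u : [\/ low u = 0, low u = u i0, low u = u i1 | low u = u i2].
Proof.
rewrite /low ![Num.min _ _]minEle; case: ifP => _; first by constructor 1.
case: ifP => _; first by constructor 2.
by case: ifP => _; [constructor 3|constructor 4].
Qed.

Let lowE u m : m <= 0 -> m <= u i0 -> m <= u i1 -> m <= u i2 ->
  [\/ m = 0, m = u i0, m = u i1 | m = u i2] -> low u = m.
Proof.
move=> m0 ma mb mc H; apply/le_anti; rewrite {2}/low !le_min m0 ma mb mc !andbT.
by have [l0 la lb lc] := low_le u; case: H => ->.
Qed.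

Let mass_gt0 u : 0 < u i0 ^+ 2 + u i1 ^+ 2 + u i2 ^+ 2 -> 0 < mass u.
Proof.
move=> u0; have [l0 la lb lc] := low_le u.
have -> : mass u = (u i0 - low u) + (u i1 - low u) + (u i2 - low u) - low u.
  by rewrite /mass; ring.
rewrite lt_def; apply/andP; split; last by lra.
apply: contraTneq u0 => E; have lu : low u = 0 by lra.
have -> : u i0 = 0 by lra.
have -> : u i1 = 0 by lra.
have -> : u i2 = 0 by lra.
by rewrite !expr0n /= !addr0 ltxx.
Qed.

Let sphereE (u : {ptws 'I_3 -> R}) : sphere R u -> u i0 ^+ 2 + u i1 ^+ 2 + u i2 ^+ 2 = 1.
Proof. by rewrite /sphere /= !big_ord_recl big_ord0 addr0 addrA. Qed.

Let of_sphereE u : [/\ of_sphere u a = (u i0 - low u) / mass u,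
  of_sphere u b = (u i1 - low u) / mass u, of_sphere u c = (u i2 - low u) / mass u
  & of_sphere u d = - low u / mass u].
Proof.
have [ba ca da] : [/\ b != a, c != a & d != a] by split; rewrite eq_sym.
have [cb db dc] : [/\ c != b, d != b & d != c] by split; rewrite eq_sym.
by split; rewrite /of_sphere !indxx !ind_neq //; congr (_ / _); ring.
Qed.

Let of_sphere0 u i : i != a -> i != b -> i != c -> i != d -> of_sphere u i = 0.
Proof.
move=> ia ib ic id_; rewrite /of_sphere !ind_neq 1?eq_sym //.
by rewrite !mulr0 !addr0 subr0 mul0r.
Qed.

Let tetrahedron_face (z : {ptws V -> R}) :
  (forall i, i != a -> i != b -> i != c -> i != d -> z i = 0) ->
  [\/ z d = 0, z a = 0, z b = 0 | z c = 0] ->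
  exists2 s, s \in tetrahedron & forall i, z i != 0 -> i \in s.
Proof.
move=> zo H; have zs i : z i != 0 -> [|| i == a, i == b, i == c | i == d].
  have [//|ia] := eqVneq i a; have [//|ib] := eqVneq i b.
  by have [//|ic] := eqVneq i c; have [//|id_] := eqVneq i d; rewrite zo ?eqxx.
case: H => e; [exists [set a; b; c]%SET|exists [set b; c; d]%SET
  |exists [set a; c; d]%SET|exists [set a; b; d]%SET] => [|i zi||i zi||i zi||i zi];
  rewrite ?inE ?eqxx ?orbT //; move: (zs i zi).
- by case: (eqVneq i d) zi => [->|_ _]; [rewrite e eqxx|do 3!case: eqP].
- by case: (eqVneq i a) zi => [->|_ _]; [rewrite e eqxx|do 3!case: eqP].
- by case: (eqVneq i b) zi => [->|_ _]; [rewrite e eqxx|do 3!case: eqP].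
by case: (eqVneq i c) zi => [->|_ _]; [rewrite e eqxx|do 3!case: eqP].
Qed.

Let sum4 (z : V -> R) : (forall i, i != a -> i != b -> i != c -> i != d -> z i = 0) ->
  \sum_i z i = z a + z b + z c + z d.
Proof.
move=> zo; rewrite (bigD1 a) //= (bigD1 b) 1?eq_sym //= (bigD1 c) /=; last first.
  by rewrite ![c == _]eq_sym ac bc.
rewrite (bigD1 d) /=; last by rewrite ![d == _]eq_sym ad bd cd.
rewrite big1 ?addr0 ?addrA // => i /andP[/andP[/andP[ia ib] ic] id_].
exact: zo.
Qed.

Let tetrahedronP (z : {ptws V -> R}) : realization R tetrahedron z ->
  [/\ forall i, i != a -> i != b -> i != c -> i != d -> z i = 0,
      [\/ z d = 0, z a = 0, z b = 0 | z c = 0],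
      forall i, 0 <= z i & z a + z b + z c + z d = 1].
Proof.
move=> [z0 z1 [s sT sz]].
have zo i : i != a -> i != b -> i != c -> i != d -> z i = 0.
  move=> /negbTE ia /negbTE ib /negbTE ic /negbTE id_; apply/eqP.
  apply: contraFT (_ : i \in s = false) => [/sz //|].
  by move: sT; rewrite !inE => /orP[/orP[/orP[]|]|] /eqP->; rewrite !inE ?ia ?ib ?ic ?id_.
split=> //; last by rewrite -z1 sum4.
have zN i : i \notin s -> z i = 0 by move=> is_; apply/eqP; apply: contraNT is_; exact: sz.
have [ba ca da] : [/\ b != a, c != a & d != a] by split; rewrite eq_sym.
have [cb db dc] : [/\ c != b, d != b & d != c] by split; rewrite eq_sym.
move: sT; rewrite !inE => /orP[/orP[/orP[]|]|] /eqP sE.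
- by constructor 1; apply: zN; rewrite sE !inE !negb_or da db dc.
- by constructor 4; apply: zN; rewrite sE !inE !negb_or ca cb cd.
- by constructor 3; apply: zN; rewrite sE !inE !negb_or ba bc bd.
by constructor 2; apply: zN; rewrite sE !inE !negb_or ab ac ad.
Qed.

(** The numbers compared by [low] are the four coordinates of [z] lowered by [z d], and the least
    coordinate is 0. *)
Let low_offset z : realization R tetrahedron z -> low (offset z) = - z d.
Proof.
case/tetrahedronP => _ H z0 _; apply: lowE; rewrite ?oppr_le0 ?z0 //.
- by rewrite /offset /= lerDr z0.
- by rewrite /offset /= lerDr z0.
- by rewrite /offset /= lerDr z0.
case: H => e; [constructor 1|constructor 2|constructor 3|constructor 4].
- by rewrite e oppr0.
- by rewrite /offset /= e sub0r.
- by rewrite /offset /= e sub0r.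
by rewrite /offset /= e sub0r.
Qed.

(** If all offsets vanish, the four coordinates are equal; one of them is 0, against the sum 1. *)
Let radius_offset z : realization R tetrahedron z -> 0 < radius (offset z).
Proof.
move=> Tz; rewrite sqrtr_gt0 lt_def !addr_ge0 ?sqr_ge0 // andbT.
apply/eqP => E; have [_ H z0 z1] := tetrahedronP Tz.
have [s0 s1 s2] : [/\ 0 <= offset z i0 ^+ 2, 0 <= offset z i1 ^+ 2 & 0 <= offset z i2 ^+ 2].
  by rewrite !sqr_ge0.
have e0 : offset z i0 = 0 by apply/eqP; rewrite -sqrf_eq0; apply/eqP; lra.
have e1 : offset z i1 = 0 by apply/eqP; rewrite -sqrf_eq0; apply/eqP; lra.
have e2 : offset z i2 = 0 by apply/eqP; rewrite -sqrf_eq0; apply/eqP; lra.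
move: e0 e1 e2; rewrite /offset /corner /= => e0 e1 e2.
case: H => e; lra.
Qed.

Let low_scale u t : 0 < t -> low (fun i => u i / t) = low u / t.
Proof.
move=> t0; have [l0 la lb lc] := low_le u.
apply: lowE; rewrite ?ler_pM2r ?invr_gt0 //; first by rewrite pmulr_lle0 ?invr_gt0.
case: (low_attained u) => ->; first by constructor 1; rewrite mul0r.
- by constructor 2.
- by constructor 3.
by constructor 4.
Qed.

Let of_to_sphere z : realization R tetrahedron z -> of_sphere (to_sphere z) = z.
Proof.
move=> Tz; have r0 := radius_offset Tz; have [zo _ z0 z1] := tetrahedronP Tz.
have rn : radius (offset z) != 0 by rewrite gt_eqF.
have lE : low (to_sphere z) = - z d / radius (offset z).
  by rewrite /to_sphere low_scale // low_offset.
have mE : mass (to_sphere z) = (radius (offset z))^-1.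
  rewrite /mass lE /to_sphere; have [-> -> ->] := offsetE z.
  by rewrite -[RHS]mul1r -[X in _ = X * _]z1; ring.
have [oa ob oc] := offsetE z.
have [Ea Eb Ec Ed] := of_sphereE (to_sphere z).
apply/funext => i.
have [->|ia] := eqVneq i a.
  by rewrite Ea mE lE /to_sphere oa; field.
have [->|ib] := eqVneq i b.
  by rewrite Eb mE lE /to_sphere ob; field.
have [->|ic] := eqVneq i c.
  by rewrite Ec mE lE /to_sphere oc; field.
have [->|id_] := eqVneq i d; first by rewrite Ed mE lE; field.
by rewrite of_sphere0 // zo.
Qed.

Let to_sphereP z : realization R tetrahedron z -> sphere R (to_sphere z).
Proof.
move=> Tz; have r0 := radius_offset Tz.
have rn : radius (offset z) != 0 by rewrite gt_eqF.
rewrite /sphere /= !big_ord_recl big_ord0 addr0 addrA /to_sphere !expr_div_n -!mulrDl.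
rewrite sqr_sqrtr ?addr_ge0 ?sqr_ge0 // divff //.
by apply: contraNneq rn => E; rewrite /radius E sqrtr0.
Qed.

Let of_sphereP u : sphere R u -> realization R tetrahedron (of_sphere u).
Proof.
move=> /sphereE u1; have m0 : 0 < mass u by apply: mass_gt0; rewrite u1.
have [l0 la lb lc] := low_le u; have [Ea Eb Ec Ed] := of_sphereE u.
have m0' := ltW m0; have zo := @of_sphere0 u; split.
- move=> i.
  have [->|ia] := eqVneq i a; first by rewrite Ea divr_ge0 // subr_ge0.
  have [->|ib] := eqVneq i b; first by rewrite Eb divr_ge0 // subr_ge0.
  have [->|ic] := eqVneq i c; first by rewrite Ec divr_ge0 // subr_ge0.
  have [->|id_] := eqVneq i d; first by rewrite Ed divr_ge0 // oppr_ge0.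
  by rewrite of_sphere0.
- rewrite sum4 // Ea Eb Ec Ed -!mulrDl [X in X / _](_ : _ = mass u).
    by rewrite divff // gt_eqF.
  by rewrite /mass; ring.
apply: tetrahedron_face => //.
case: (low_attained u) => e; [constructor 1|constructor 2|constructor 3|constructor 4].
- by rewrite Ed e oppr0 mul0r.
- by rewrite Ea e subrr mul0r.
- by rewrite Eb e subrr mul0r.
by rewrite Ec e subrr mul0r.
Qed.

Let to_of_sphere u : sphere R u -> to_sphere (of_sphere u) = u.
Proof.
move=> Su; have u1 := sphereE Su; have m0 : 0 < mass u by apply: mass_gt0; rewrite u1.
have [Ea Eb Ec Ed] := of_sphereE u; have mn : mass u != 0 by rewrite gt_eqF.
have oE i : offset (of_sphere u) i = u i / mass u.
  case: (ord3P i) => ->; rewrite /offset /corner /= ?Ea ?Eb ?Ec Ed -mulrBl;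
    by congr (_ / _); ring.
have rE : radius (offset (of_sphere u)) = (mass u)^-1.
  rewrite /radius !oE !expr_div_n -!mulrDl u1 mul1r sqrtrV ?sqr_ge0 //.
  by rewrite sqrtr_sqr ger0_norm // ltW.
by apply/funext => i; rewrite /to_sphere rE oE invrK mulfVK.
Qed.

Let offset_continuous k : continuous (fun z : {ptws V -> R} => offset z k).
Proof.
by move=> z; exact: (continuousB (@ptws_coord_continuous R V (corner k) z)
  (@ptws_coord_continuous R V d z)).
Qed.

Let to_sphere_continuous z :
  realization R tetrahedron z -> {for z, continuous to_sphere}.
Proof.
move=> Tz; apply: ptws_continuous_at => k.
have sq j : {for z, continuous (fun z : {ptws V -> R} => offset z j ^+ 2)}.
  exact: (continuousM (@offset_continuous j z) (@offset_continuous j z)).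
have rc : {for z, continuous (fun z : {ptws V -> R} => radius (offset z))}.
  by apply: (continuous_comp (continuousD (continuousD (sq i0) (sq i1)) (sq i2)));
    exact: sqrt_continuous.
have rn : radius (offset z) != 0 by rewrite gt_eqF // radius_offset.
have rVc := @continuousV _ _ (fun z : {ptws V -> R} => radius (offset z)) z rn rc.
exact: (continuousM (@offset_continuous k z) rVc).
Qed.

Let of_sphere_continuous u : sphere R u -> {for u, continuous of_sphere}.
Proof.
move=> /sphereE u1; have mn : mass u != 0 by rewrite gt_eqF // mass_gt0 // u1.
apply: ptws_continuous_at => i.
have cc (s : R) : {for u, continuous (fun _ : {ptws 'I_3 -> R} => s)} by exact: cst_continuous.
have uc k : {for u, continuous (fun u : {ptws 'I_3 -> R} => u k)}.
  exact: ptws_coord_continuous.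
have lc : {for u, continuous low}.
  exact: (continuous_min (cc 0) (continuous_min (uc i0) (continuous_min (uc i1) (uc i2)))).
have mc : {for u, continuous mass}.
  have sc := continuousD (continuousD (uc i0) (uc i1)) (uc i2).
  exact: (continuousB sc (continuousM (cc 4) lc)).
have wc k (t : R) : {for u, continuous (fun u : {ptws 'I_3 -> R} => (u k - low u) * t)}.
  exact: (continuousM (continuousB (uc k) lc) (cc t)).
exact: (continuousM (continuousB (continuousD (continuousD (wc i0 (ind R a i))
  (wc i1 (ind R b i))) (wc i2 (ind R c i))) (continuousM lc (cc (ind R d i))))
  (continuousV mn mc)).
Qed.

Lemma tetrahedron_sphere : homeomorphic (realization R tetrahedron) (sphere R).
Proof.
exists to_sphere, of_sphere; split.
- apply: continuous_in_subspaceT => z /set_mem; exact: to_sphere_continuous.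
- apply: continuous_in_subspaceT => u /set_mem; exact: of_sphere_continuous.
- by move=> z Tz; split; [exact: to_sphereP|exact: of_to_sphere].
by move=> u Su; split; [exact: of_sphereP|exact: to_of_sphere].
Qed.

End Tetrahedron.

(** * Crossing chords *)

Section Chords.

Variable T : eqType.
Implicit Types (p : seq T) (x y z : T).

Lemma cyc_nth x0 p i : uniq p -> i.+1 < size p ->
  cyc p (nth x0 p i) (nth x0 p i.+1).
Proof.
move=> up li; have li' := ltnW li.
rewrite -(cyc_rot i up) /rot (drop_nth x0 li') (drop_nth x0 li) /=.
rewrite cyc_head ?eqxx // -!cat_cons -(drop_nth x0 li) -(drop_nth x0 li').
by rewrite -/(rot i p) rot_uniq.
Qed.

(* The crossed chord joins two positions of minimal distance. *)
Lemma crossing_chords (e : rel T) p : symmetric e -> uniq p -> p != [::] ->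
  (forall x, x \in p -> exists y, [/\ y \in p, e x y, y != x & ~~ cyc p x y]) ->
  exists n x s y t x' y',
    [/\ rot n p = x :: s ++ y :: t, x' \in s, y' \in t, e x y & e x' y'].
Proof.
move=> es up; case: p up => // x0 p0; set p := x0 :: p0 => up _ H.
pose E i j := e (nth x0 p i) (nth x0 p j) && ~~ cyc p (nth x0 p i) (nth x0 p j).
have Hn i : i < size p -> exists j, [/\ j < size p, E i j & j != i].
  move=> li; have [y [yp exy yx nc]] := H _ (mem_nth x0 li).
  exists (index y p); split; first by rewrite index_mem.
    by rewrite /E nth_index // exy.
  by apply: contraNneq yx => <-; rewrite nth_index.
have EC i j : E i j = E j i by rewrite /E es cycC.
pose P k := [exists i : 'I_(size p), exists j : 'I_(size p),
  [&& (i < j)%N, (j - i == k)%N & E i j]].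
have exP : exists k, P k.
  have [j [lj Ej j0]] := Hn 0 isT.
  exists j; apply/existsP; exists ord0; apply/existsP; exists (Ordinal lj).
  by rewrite /= lt0n j0 subn0 eqxx.
have [k /existsP[i /existsP[j /and3P[ij /eqP jk Eij]]] kmin] := ex_minnP exP.
have li1 : i.+1 < size p by apply: leq_ltn_trans ij (ltn_ord j).
(* A chord is not an edge of the cycle, so position [i.+1] lies strictly between its ends; the chord
   starting there is the crossing one. *)
have ij1 : i.+1 < j.
  rewrite ltn_neqAle ij andbT; apply: contraTneq Eij => <-.
  by rewrite /E cyc_nth // andbF.
have [l [ll El l1]] := Hn _ li1.
(* An end [l] between [i] and [j] is impossible: [l = i] is consecutive to [i.+1], and beyond [i.+1]
   the chord would be shorter than the minimum. *)
have Hl : (l < i) || (j < l).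
  rewrite ltnNge (ltnNge j) -negb_and; apply/negP => /andP[il lj].
  move: il; rewrite leq_eqVlt => /orP[/eqP il|il].
    by move: El; rewrite -il EC /E cyc_nth // andbF.
  have il1 : i.+1 < l by rewrite ltn_neqAle eq_sym l1.
  suff /kmin : P (l - i.+1) by rewrite -jk; lia.
  by apply/existsP; exists (Ordinal li1); apply/existsP; exists (Ordinal ll);
    rewrite /= il1 eqxx.
exists i, (nth x0 p i), (take (j - i.+1) (drop i.+1 p)), (nth x0 p j).
exists (drop j.+1 p ++ take i p), (nth x0 p i.+1), (nth x0 p l); split.
- rewrite /rot (drop_nth x0 (ltn_ord i)) cat_cons; congr cons.
  rewrite -{1}(cat_take_drop (j - i.+1) (drop i.+1 p)) drop_drop subnK //.
  by rewrite (drop_nth x0 (ltn_ord j)) -!catA cat_cons.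
- have -> : nth x0 p i.+1 = nth x0 (take (j - i.+1) (drop i.+1 p)) 0.
    by rewrite nth_take ?subn_gt0 // nth_drop addn0.
  by rewrite mem_nth // size_take size_drop; case: ifP => _; lia.
- rewrite mem_cat; case/orP: Hl => Hl; apply/orP; [right|left].
    rewrite -(nth_take x0 Hl) mem_nth // size_take ltn_ord //.
  have -> : nth x0 p l = nth x0 (drop j.+1 p) (l - j.+1).
    by rewrite nth_drop subnKC.
  by rewrite mem_nth // size_drop; lia.
- by case/andP: Eij.
by case/andP: El.
Qed.

End Chords.

(** * Crossing 3-cycles are nonseparating *)

Section Nonseparating.

Local Open Scope set_scope.

Variables (R : realType) (V : finType) (F : {set {set V}}).
Implicit Types (u v x y z : V) (p s t : seq V).
Hypotheses (t3 : triples F) (hl : has_links F).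

Lemma link_sorted v p : link F v p -> sorted (adj F) p.
Proof.
case=> up _ H; case: p up H => // x p up H; apply/(sortedP x) => i li.
have : [set v; nth x (x :: p) i; nth x (x :: p) i.+1] \in F by rewrite H cyc_nth.
by case/(face_adj t3).
Qed.

Lemma off_rel_sym (C : {set V}) : symmetric (off_rel F C).
Proof. by move=> x y; rewrite /off_rel adjC [X in _ && X]andbC. Qed.

Lemma sorted_connect (C : {set V}) s x y : sorted (adj F) s ->
  (forall z, z \in s -> z \notin C) -> x \in s -> y \in s ->
  connect (off_rel F C) x y.
Proof.
move=> ss sC; have se : sorted (off_rel F C) s.
  case: s ss sC => // a s; rewrite /sorted; elim: s a => //= b s IH a.
  case/andP=> ab pb sC; rewrite /off_rel ab !sC ?inE ?eqxx ?orbT //=.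
  by apply: IH => // z zs; apply: sC; rewrite inE zs orbT.
case: s se {ss sC} => // a s se xs ys.
apply: (@connect_trans _ _ a); last exact: (path_connect se).
rewrite (sym_connect_sym (off_rel_sym C)); exact: (path_connect se).
Qed.

(** Each arc of the link left by deleting [z1] and [z2] is a path off [C], so reaching one vertex on
    each arc reaches every neighbour of [u] off [C]. *)
Lemma link_arcs_connect u z1 z2 t1 t2 x0 x y (C := [set u; z1; z2]) :
  link F u (z1 :: t1 ++ z2 :: t2) -> x \in t1 -> y \in t2 ->
  connect (off_rel F C) x0 x -> connect (off_rel F C) x0 y ->
  forall z, adj F u z -> z \notin C -> connect (off_rel F C) x0 z.
Proof.
move=> L xt yt cx cy z uz zC.
have un := link_notin t3 L; have [ul _ _] := L.
have := link_sorted L; rewrite -cat_rcons -cat1s => sl.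
have [_ /cat_sorted2[s1 s2]] := cat_sorted2 sl.
have s1' : sorted (adj F) t1 by move: s1; rewrite -cats1 => /cat_sorted2[].
have := ul; rewrite /= mem_cat cat_uniq in_cons !negb_or.
case/andP=> /and3P[z1t1 z12 z1t2] /and3P[u1 /andP[z2t1 _] /andP[z2t2 _]].
have t1C w : w \in t1 -> w \notin C.
  move=> wt; rewrite !inE !negb_or; apply/andP; split; first (apply/andP; split).
  - by apply: contraNneq un => <-; rewrite in_cons mem_cat wt orbT.
  - by apply: contraNneq z1t1 => <-.
  by apply: contraNneq z2t1 => <-.
have t2C w : w \in t2 -> w \notin C.
  move=> wt; rewrite !inE !negb_or; apply/andP; split; first (apply/andP; split).
  - by apply: contraNneq un => <-; rewrite in_cons mem_cat in_cons wt !orbT.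
  - by apply: contraNneq z1t2 => <-.
  by apply: contraNneq z2t2 => <-.
move: uz; rewrite -(link_adj z t3 L) in_cons mem_cat in_cons.
case: (eqVneq z z1) zC => [->|_ zC]; first by rewrite !inE eqxx orbT.
case: (eqVneq z z2) zC => [->|_ zC] /=; first by rewrite !inE eqxx orbT.
case/orP=> zt.
  exact: connect_trans cx (sorted_connect s1' t1C xt zt).
exact: connect_trans cy (sorted_connect s2 t2C yt zt).
Qed.

(** Carries both sides of the cycle from [z1] to [u]. The third vertices of the two faces at the
    edge [u z1] lie one on each arc of the link of [u], and they are neighbours of [z1], hence
    reached; neither is [z2], because [C] is not a face. *)
Lemma link_neighbor_connect u z1 z2 x0 (C := [set u; z1; z2]) :
  [set u; z1; z2] \notin F -> adj F u z1 -> adj F u z2 -> z1 != z2 ->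
  (forall x, adj F z1 x -> x \notin C -> connect (off_rel F C) x0 x) ->
  forall z, adj F u z -> z \notin C -> connect (off_rel F C) x0 z.
Proof.
move=> nF uz1 uz2 z12 Hz1.
have uF : u \in vertices F by apply: (adj_vertices (x := z1)); rewrite adjC.
have [p L] := hl uF; have z1p : z1 \in p by rewrite (link_adj _ t3 L).
have [n [r [_ Lr]]] := link_from L z1p.
have : z2 \in z1 :: r by rewrite (link_adj _ t3 Lr).
rewrite in_cons eq_sym (negbTE z12) /= => /splitPr E.
case: E Lr => t1 t2 Lr; have [ul _ Hl] := Lr.
have un := link_notin t3 Lr.
have hd x : [set u; z1; x] \in F -> x != z2 -> connect (off_rel F C) x0 x.
  move=> H xz2; have [_ ux z1x] := set3_face t3 H.
  apply: Hz1; first by have [_ _] := face_adj t3 H.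
  by rewrite !inE !negb_or xz2 ![x == _]eq_sym ux z1x.
move: nF; rewrite Hl cyc_head //.
case: t1 Lr ul Hl un => [|x t1] Lr ul Hl un; first by rewrite /= eqxx.
case/lastP: t2 Lr ul Hl un => [|t2 y] Lr ul Hl un.
  by rewrite last_cat /= eqxx orbT.
move=> _; apply: (link_arcs_connect (x := x) (y := y) Lr).
- exact: mem_head.
- by rewrite mem_rcons mem_head.
- apply: hd; first by rewrite Hl cyc_head //= eqxx.
  by apply: contraTneq ul => ->; rewrite /= mem_cat mem_head orbT /= andbF.
apply: hd; first by rewrite Hl cyc_head // last_cat last_cons last_rcons eqxx orbT.
apply: contraTneq ul => ->.
by rewrite /= cat_uniq /= mem_rcons mem_head !andbF.
Qed.

(* A second 3-cycle crosses v vi vk exactly once, at v, so it joins the two sides. *)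
Lemma crossing_nonseparating v vi vk s2 s3 vj vl :
  connected (realization R F) ->
  link F v (vi :: s2 ++ vk :: s3) -> vj \in s2 -> vl \in s3 ->
  adj F vi vk -> adj F vj vl -> nonseparating3 R F v vi vk.
Proof.
move=> cF L js ls ik jl; set C := [set v; vi; vk].
have [ul _ Hl] := L; have un := link_notin t3 L.
have nF : C \notin F.
  rewrite Hl cyc_cons_split //; first by case: (s2) js.
  by case: (s3) ls.
have vvi : adj F v vi by rewrite -(link_adj _ t3 L) mem_head.
have vvk : adj F v vk by rewrite -(link_adj _ t3 L) in_cons mem_cat mem_head !orbT.
have vvj : adj F v vj by rewrite -(link_adj _ t3 L) in_cons mem_cat js !orbT.
have vvl : adj F v vl by rewrite -(link_adj _ t3 L) in_cons mem_cat in_cons ls !orbT.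
have c3 : cycle3 F v vi vk by rewrite /cycle3 vvi ik vvk.
have := ul; rewrite /= mem_cat cat_uniq in_cons !negb_or.
case/andP=> /and3P[i2 nik i3] /and3P[u1 /andP[k2 _] /andP[k3 _]].
have jC : vj \notin C.
  rewrite !inE !negb_or; apply/andP; split; first (apply/andP; split).
  - by rewrite eq_sym; case/andP: vvj.
  - by apply: contraNneq i2 => <-.
  by apply: contraNneq k2 => <-.
have lC : vl \notin C.
  rewrite !inE !negb_or; apply/andP; split; first (apply/andP; split).
  - by rewrite eq_sym; case/andP: vvl.
  - by apply: contraNneq i3 => <-.
  by apply: contraNneq k3 => <-.
(* Here the second cycle enters: its edge [vj vl] joins the two arcs of the link of [v] outside
   [C]. *)
have cjl : connect (off_rel F C) vj vl by apply: connect1; rewrite /off_rel jl jC.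
have Hv := link_arcs_connect L js ls (connect0 _ vj) cjl.
have Hi : forall z, adj F vi z -> z \notin C -> connect (off_rel F C) vj z.
  have CE : [set vi; v; vk] = C by rewrite /C set3CA.
  have := @link_neighbor_connect vi v vk vj; rewrite CE; apply => //.
  - by rewrite adjC.
  - by case/andP: vvk.
have Hk : forall z, adj F vk z -> z \notin C -> connect (off_rel F C) vj z.
  have CE : [set vk; v; vi] = C by rewrite set3_rot.
  have := @link_neighbor_connect vk v vi vj; rewrite CE; apply => //.
  - by rewrite adjC.
  - by rewrite adjC.
  - by case/andP: vvi.
have jF := adj_vertices vvj.
split=> //; apply: (connected_off_curve nF t3 c3 jF jC) => y yF yC.
(* By [Hv], [Hi] and [Hk] this set is closed under adjacency, so it contains every vertex. *)
pose A := [set z | (z \in C) || connect (off_rel F C) vj z].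
have : y \in A.
  apply: (connected_vertices (x := vj) cF) => //; last by rewrite inE connect0 orbT.
  move=> u z; rewrite !inE => uA uz; case: (boolP (z \in C)) => zC.
    by move: zC; rewrite !inE => ->.
  apply/orP; right; have [uC|uC] := boolP (u \in C).
    move: uC uz; rewrite !inE -orbA => /or3P[]/eqP-> uz.
    - exact: Hv.
    - exact: Hi.
    exact: Hk.
  have cu : connect (off_rel F C) vj u by case/orP: uA => // uC'; case/negP: uC; rewrite !inE.
  by apply: connect_trans cu _; apply: connect1; rewrite /off_rel uz uC.
by rewrite inE (negbTE yC).
Qed.

End Nonseparating.

(** * Irreducible triangulations *)

Section Irreducible.

Local Open Scope set_scope.

Variables (R : realType) (V : finType) (F : {set {set V}}).
Implicit Types (a b c d u v w x y z : V) (p q s t : seq V).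

Lemma triangulation_triples : triangulation R F -> triples F.
Proof. by case. Qed.

Lemma triangulation_links : triangulation R F -> has_links F.
Proof. by case=> _ _ H _ v /H[p /is_linkP L]; exists p. Qed.

Lemma contract_contractible a c y q : triangulation R F -> link F c [:: a, y & q] ->
  (forall u, u \in q -> u != last y q -> ~~ adj F a u) ->
  [set a; y; last y q] \notin F -> contractible_edge R F a c.
Proof.
move=> trF L nadj nF; have t3 := triangulation_triples trF.
have hl := triangulation_links trF; have [F0 _ _ cF] := trF.
have [t3' hl' /(@ambient_homeomorphic R V) h] := contract_homeo R t3 hl L nadj nF.
have [h1 h2] : homeomorphic (realization R F) (realization R (contract_edge F a c)) /\
  homeomorphic (realization R (contract_edge F a c)) (realization R F).
  split=> //; have [f [g [? ? ? ?]]] := h; by exists g, f.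
split=> //; first by rewrite adjC -(link_adj _ t3 L) mem_head.
split=> //; last exact: homeomorphic_connected h cF.
  (* The contraction has a face because the homeomorphism sends a vertex of [F] to a point of its
     realization. *)
  have /finset.set0Pn[f fF] := F0.
  have /card_gt0P[x xf] : 0 < #|f| by rewrite t3.
  have xF : x \in vertices F by apply/mem_vertices; exists f.
  have [k [_ [_ _ /(_ _ (realization_ind R xF))[[_ _ [s sF _]] _] _]]] := h.
  by apply/finset.set0Pn; exists s.
by move=> v /hl'[p L']; exists p; apply/is_linkP.
Qed.

(** The four faces fill the links of the four vertices, so no other face meets these vertices, and
    connectedness leaves no further vertex. *)
Lemma tetrahedron_faces a b c d : triangulation R F ->
  [set a; b; c] \in F -> [set a; b; d] \in F ->
  [set a; c; d] \in F -> [set b; c; d] \in F -> F = tetrahedron a b c d.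
Proof.
move=> trF abc abd acd bcd; have t3 := triangulation_triples trF.
have hl := triangulation_links trF; have [_ _ _ cF] := trF.
have [ab ac bc] := set3_face t3 abc; have [_ ad bd] := set3_face t3 abd.
have [_ _ cd] := set3_face t3 acd.
have La : link F a [:: b; c; d] by apply: link_triangle => //; rewrite set3C.
have bac : [set b; a; c] \in F by rewrite set3CA.
have bda : [set b; d; a] \in F by rewrite -(set3_rot a b d).
have Lb : link F b [:: a; c; d] by exact: link_triangle.
have cab : [set c; a; b] \in F by rewrite set3_rot.
have cbd : [set c; b; d] \in F by rewrite set3CA.
have cda : [set c; d; a] \in F by rewrite -(set3_rot a c d).
have Lc : link F c [:: a; b; d] by exact: link_triangle.
have dab : [set d; a; b] \in F by rewrite set3_rot.
have dbc : [set d; b; c] \in F by rewrite set3_rot.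
have dca : [set d; c; a] \in F by rewrite -(set3_rot a d c) set3C.
have Ld : link F d [:: a; b; c] by exact: link_triangle.

have FT f u : f \in F -> u \in f -> u \in [set a; b; c] :|: [set d] ->
    f \in tetrahedron a b c d.
  move=> fF uf; rewrite !inE -!orbA => /or4P[]/eqP E; rewrite E in uf.
  - by case: (remove3_faces t3 La fF uf) => ->; rewrite eqxx ?orbT.
  - by case: (remove3_faces t3 Lb fF uf) => ->; rewrite ?(set3CA b a) eqxx ?orbT.
  - case: (remove3_faces t3 Lc fF uf) => ->.
    + by rewrite (set3_rot c a b) eqxx.
    + by rewrite (set3CA c a d) eqxx !orbT.
    by rewrite (set3CA c b d) eqxx !orbT.
  case: (remove3_faces t3 Ld fF uf) => ->; rewrite (set3_rot d) eqxx ?orbT //.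
have TF : tetrahedron a b c d \subset F.
  by apply/fintype.subsetP => f; rewrite mem_tetrahedron => /or4P[]/eqP->.
apply/eqP; rewrite finset.eqEsubset TF andbT; apply/fintype.subsetP => f fF.
have /card_gt0P[x xf] : 0 < #|f| by rewrite t3.
apply: (FT f x) => //.
have aF : a \in vertices F by have [] := face_vertices abc.
apply: (connected_vertices (x := a) cF) => //; last by apply/mem_vertices; exists f.
  move=> u y uA /andP[_ /existsP[g /andP[gF /andP[ug yg]]]].
  have := FT g u gF ug uA; rewrite mem_tetrahedron.
  case/or4P=> /eqP E; move: yg; rewrite E !inE -?orbA;
    by case/or3P=> ->; rewrite ?orbT.
by rewrite !inE eqxx.
Qed.

(** Let [v] have degree three. If its neighbours span a face, [F] is a tetrahedron and its
    realization a sphere; otherwise [wv] is contractible, the nonadjacency condition being vacuous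
    for so short a link. *)
Lemma irreducible_link_size v p : irreducible_triangulation R F ->
  ~ homeomorphic (realization R F) (sphere R) -> link F v p -> 3 < size p.
Proof.
move=> [trF irr] ns L; have t3 := triangulation_triples trF.
have [_ sp _] := L; rewrite ltn_neqAle sp andbT; apply/negP => /eqP sp3.
case: p sp3 L sp => [|w [|x [|y [|? ?]]]] //= _ L _.
have [ul _ Hl] := L.
have vwx : [set v; w; x] \in F by rewrite Hl cyc_cons3 upair_refl.
have vxy : [set v; x; y] \in F by rewrite Hl cyc_cons3 upair_refl orbT.
have vwy : [set v; w; y] \in F by rewrite Hl cyc_head //= eqxx orbT.
have [wxyF|wxyF] := boolP ([set w; x; y] \in F).
  apply: ns; rewrite (tetrahedron_faces trF vwx vwy vxy wxyF).
  have [vw vx wx] := set3_face t3 vwx; have [_ vy xy] := set3_face t3 vxy.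
  by have [_ _ wy] := set3_face t3 vwy; exact: tetrahedron_sphere.
apply: (irr w v); apply: (contract_contractible trF L) => // u.
by rewrite inE => /eqP->; rewrite /= eqxx.
Qed.

(** Without a chord at [w], a common neighbour [u] of [v] and [w] is consecutive to [w] in the link
    of [v], so [vwu] is a face and [u] is next to [v] in the link of [w]. Then [vw] meets the
    criterion for contraction. *)
Lemma irreducible_chord v p w : irreducible_triangulation R F ->
  link F v p -> 3 < size p -> w \in p ->
  exists z, [/\ z \in p, adj F w z, z != w & ~~ cyc p w z].
Proof.
move=> [trF irr] L sp wp; have t3 := triangulation_triples trF.
have hl := triangulation_links trF.
have [/existsP[z /and4P[? ? ? ?]]|N] := boolP
    [exists z, [&& z \in p, adj F w z, z != w & ~~ cyc p w z]]; first by exists z.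
have {}N z : z \in p -> adj F w z -> cyc p w z.
  move=> zp wz; apply: contraR N => nc; apply/existsP; exists z.
  by rewrite zp wz nc eq_sym; case/andP: wz => ->.
case: (irr v w).
have vw : adj F v w by rewrite -(link_adj _ t3 L).
have [up _ Hl] := L.
have wF := adj_vertices vw; have [pw Lw] := hl w wF.
have vpw : v \in pw by rewrite (link_adj _ t3 Lw) adjC.
have [n [s [_ {}Lw]]] := link_from Lw vpw.
case: s Lw => [|y q] Lw; first by case: Lw.
have [uw sw Hw] := Lw.
apply: (contract_contractible trF Lw).
  move=> u uq ul; apply/negP => vu.
  have wu : adj F w u by rewrite -(link_adj _ t3 Lw) 2!in_cons uq !orbT.
  have up' : u \in p by rewrite (link_adj _ t3 L).
  have : [set w; v; u] \in F by rewrite set3CA Hl N.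
  rewrite Hw cyc_head //= (negbTE ul) orbF => /eqP E.
  by move: uw; rewrite -E /= uq !andbF.
(* This face would close the link of [v] to the triangle [w], [y], [last y q], against
   [3 < size p]. *)
apply/negP => vyx.
have wvy : [set v; w; y] \in F by rewrite set3CA Hw cyc_head //= eqxx.
have wvx : [set v; last y q; w] \in F.
  by rewrite -(set3_rot w v) Hw cyc_head //= eqxx orbT.
have wx : w != last y q.
  by have [_ _] := set3_face t3 wvx; rewrite eq_sym.
have L3 := link_triangle hl wvy vyx wvx wx.
suff : size p <= size [:: w; y; last y q] by rewrite /= leqNgt sp.
apply: uniq_leq_size up _ => u.
by rewrite (link_adj _ t3 L) -(link_adj _ t3 L3).
Qed.

End Irreducible.

Theorem theorem4p1 (R : realType) (V : finType) (F : {set {set V}})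
    (irrF : irreducible_triangulation R F)
    (not_sphere : ~ homeomorphic (realization R F) (sphere R))
    (v : V) (vF : v \in vertices F)
    (p : seq V) (lkv : is_link F v p) :
  exists vi vj vk vl : V,
    [/\ uniq [:: vi; vj; vk; vl],
        nonseparating3 R F v vi vk,
        nonseparating3 R F v vj vl
      & (vj \in link_path p vi vk /\ vl \in link_path p vk vi) \/
        (vl \in link_path p vi vk /\ vj \in link_path p vk vi)].
Proof.
have [trF _] := irrF; have t3 := triangulation_triples trF.
have hl := triangulation_links trF; have [_ _ _ cF] := trF.
move/is_linkP: lkv => L; have [up sp _] := L.
have sp4 := irreducible_link_size irrF not_sphere L.
have p0 : p != [::] by case: (p) sp.
have [n [vi [s [vk [t [vj [vl [E js lt ik jl]]]]]]]] :=
  crossing_chords (@adjC V F) up p0 (fun w => irreducible_chord irrF L sp4).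
have L' : link F v (vi :: s ++ vk :: t) by rewrite -E; exact: link_rot.
have [u' _ _] := L'.
have ip : vi \in p by rewrite -(mem_rot n) E mem_head.
have kp : vk \in p by rewrite -(mem_rot n) E in_cons mem_cat mem_head !orbT.
exists vi, vj, vk, vl; split.
- have [[i2 nik i3] [k2 jt k3]] : [/\ vi \notin s, vi != vk & vi \notin t] /\
      [/\ vk \notin s, ~~ has [in s] t & vk \notin t].
    move: u'; rewrite /= mem_cat cat_uniq in_cons !negb_or.
    by case/andP=> /and3P[-> -> ->] /and3P[_ /andP[-> ->] /andP[-> _]].
  rewrite /= !inE !negb_or nik andbT.
  apply/and3P; split.
  + apply/andP; split; first by apply: contraNneq i2 => ->.
    by apply: contraNneq i3 => ->.
  + apply/andP; split; first by apply: contraNneq k2 => <-.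
    apply: contra jt => /eqP jl'; apply/hasP; exists vl => //.
    by rewrite -jl'.
  by apply: contraNneq k3 => ->.
- exact: crossing_nonseparating L' js lt ik jl.
(* Crossing is symmetric: rotating the link to start at [vj] puts [vk] on one arc between [vj] and
   [vl] and [vi] on the other, so the same lemma applies with the chords exchanged. *)
- case/splitPr: js L' => s1 s2 L'; case/splitPr: lt L' => t1 t2 L'.
  have L2 : link F v (vj :: (s2 ++ vk :: t1) ++ vl :: t2 ++ vi :: s1).
    have := link_rot (size (vi :: s1)) L'.
    rewrite -(catA s1) -cat_cons rot_size_cat.
    by rewrite !cat_cons -!catA !cat_cons -!catA.
  apply: (crossing_nonseparating (vj := vk) (vl := vi) t3 hl cF L2 _ _ jl).
  + by rewrite mem_cat mem_head orbT.
  + by rewrite mem_cat mem_head orbT.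
  by rewrite adjC.
(* The chords were found after a rotation of [p] without reversal, so [vj] lies on the arc from [vi]
   to [vk] in the orientation of [p] itself. *)
left; rewrite /link_path -!(arc_rot n up) ?mem_rot // E left_arc // right_arc //.
by rewrite !mem_rcons !in_cons js lt !orbT.
Qed.
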